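(* Let $(X,S,\mu)$ be an ergodic measure-preserving system on a compact metric (Borel) space $X$ with $h(S,\mu)>0$, and let $\mathcal A$ be a finite partition of $X$ such that $\bigvee_{i\ge0}S^{-i}\mathcal A$ generates the Borel $\sigma$-algebra and $\mu$ gives zero measure to the boundaries of all sets in $S^{-i}\mathcal A$, $i\in\mathbb{N}$. Let $\varepsilon\in(0,1)$ and let $\alpha\in(0,1)$ be irrational. Then for every $\delta\in(0,1)$ there exist a constant $c_\delta>0$ and a set $X'_\delta\subset X$ with $\mu(X'_\delta)=1$ such that: for every $n\ge1$, every $x\in X'_\delta$ and every $K\subset\mathbb{N}$ with lower natural density $\rho>2\delta+\varepsilon$, there is a collection $\mathcal M_n=\mathcal M_n(x,K)$ of at most $c_\delta2^{n\delta}$ atoms of $\bigvee_{i=0}^nS^{-i}\mathcal A$, with union $M_n$, such that, setting $K'(x)=\{k\in\mathbb{N}:S^kx\in M_n\}$, the set \[ A_{K\cap K'(x)}(\alpha)=\overline{\{\{k\alpha\}:k\in K\cap K'(x)\}} \] has Lebesgue measure at least $\varepsilon$.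
   Context: $h(S,\mu)$ is the measure-theoretic entropy. $\bigvee_{i=0}^nS^{-i}\mathcal A$ is the partition generated by the sets $S^{-i}A$, $A\in\mathcal A$, $0\le i\le n$; its atoms are the nonempty sets $\{x: x\in A_0, Sx\in A_1,\dots,S^nx\in A_n\}$ with $A_j\in\mathcal A$. $\{x\}$ is the fractional part; lower natural density of $K$ is $\liminf_n\#(K\cap[1,n])/n$. *)

(* Defs.v *)
From HB Require Import structures.
From mathcomp Require Import all_boot all_order all_algebra.
From mathcomp Require Import all_classical all_reals all_analysis.
Set Implicit Arguments. Unset Strict Implicit. Unset Printing Implicit Defensive.
Import Order.TTheory GRing.Theory Num.Theory.
Import numFieldNormedType.Exports.
Local Open Scope classical_set_scope.
Local Open Scope ring_scope.

Notation borelType X := (g_sigma_algebraType (@open X)).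

Section ergodic_defs.
Context (R : realType) (X : pseudoPMetricType R).
Implicit Types (mu : probability (borelType X) R) (S : X -> X).

Definition measure_preserving mu S :=
  measurable_fun [set: borelType X] (S : borelType X -> borelType X) /\
  forall B : set (borelType X), measurable B -> mu (S @^-1` B) = mu B.

Definition ergodic mu S :=
  forall B : set (borelType X), measurable B -> S @^-1` B = B ->
    mu B = 0%E \/ mu B = 1%E.

Definition is_fin_partition k (P : 'I_k -> set X) :=
  (forall j, measurable (P j : set (borelType X))) /\
  (forall i j, i != j -> P i `&` P j = set0) /\
  (forall x, exists j, P j x).

(* the element of \/_{i<n} S^{-i} P with itinerary w (possibly empty) *)
Definition cylinder k (P : 'I_k -> set X) S n (w : {ffun 'I_n -> 'I_k}) : set X :=
  [set x | forall i : 'I_n, P (w i) (iter i S x)].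

(* Shannon entropy of a finite family of sets (0 log 0 = 0 since ln 0 = 0) *)
Definition part_entropy mu (I : finType) (Q : I -> set X) : R :=
  - \sum_(i : I) fine (mu (Q i)) * ln (fine (mu (Q i))).

Definition join_entropy mu S k (P : 'I_k -> set X) n : R :=
  part_entropy mu (@cylinder k P S n).

Definition rel_entropy mu S k (P : 'I_k -> set X) : R :=
  limn (fun n => join_entropy mu S P n.+1 / n.+1%:R).

Definition ks_entropy mu S : \bar R :=
  ereal_sup [set r | exists k (P : 'I_k -> set X),
                       is_fin_partition P /\ r = (rel_entropy mu S P)%:E].

Definition generating S k (P : 'I_k -> set X) :=
  <<s [set B | exists i j, B = (iter i S) @^-1` (P j)] >> = <<s @open X >>.

Definition boundary (A : set X) : set X := closure A `\` interior A.

End ergodic_defs.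

Definition lower_density (R : realType) (K : set nat) : R :=
  limn_inf (fun n : nat =>
    (\sum_(1 <= j < n.+2) ((j \in K) : nat))%:R / n.+1%:R).

Definition fracpart (R : realType) (x : R) : R := x - (Num.floor x)%:~R.

(* Main.v *)
(* Fix a finitely additive, shift invariant mean E on the integers, namely a limit of
   the averages over [1, N] along an ultrafilter; under E, an integer j carries the
   name w of S^j x of length n + 1 and the cell q of {j alpha} in the partition of the
   circle into m intervals.  The names q of the rotation along r blocks take only
   O(m r) values, so conditioning on q does not lower the entropy rate of the words
   w: E-entropy(w | q) >= (n + 1) h, whereas the entropy of w is at most
   (n + 1) (h + gamma) for large n.  Hence w and q have mutual information at most
   gamma (n + 1) + O(1), uniformly in m, and outside a set of pairs of mass at most
   delta one has P(w, q) <= 2^(n delta) P(w) P(q) up to a constant.  Therefore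
   O(2^(n delta)) words drawn independently with the law of w reach all cells q seen
   along K, up to mass 2 delta.  The number of words does not depend on m, so some
   choice works for infinitely many m, and each cell has mass at most 1 / (m - 1).
   Only the frequencies of the words along the orbit of x matter, and a maximal
   inequality makes them converge for almost every x. *)
Require Import Defs.
From HB Require Import structures.
From mathcomp Require Import all_boot all_order all_algebra.
From mathcomp Require Import all_classical all_reals all_analysis.
From mathcomp Require Import measurable_realfun ring lra.
Import Order.TTheory GRing.Theory Num.Theory.
Import numFieldNormedType.Exports.
Local Open Scope classical_set_scope.
Local Open Scope ring_scope.

(** * Invariant means on bounded sequences *)

Section Mean.
Set Implicit Arguments. Unset Strict Implicit. Unset Printing Implicit Defensive.
Context {R : realType}.
Implicit Types (f g : nat -> R) (c : R).

Definition bounded_seq f := exists C, forall j, `|f j| <= C.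

(* Averages over [1, N + 1], to match [lower_density]. *)
Definition avg f (N : nat) : R := (\sum_(1 <= j < N.+2) f j) / N.+1%:R.

(** The clause [mean_ge], with its eventual bound on averages, yields positivity, normalisation,
    shift invariance and the comparison with [lower_density]. *)
Record mean (E : (nat -> R) -> R) : Prop := Mean {
  meanD : forall f g, bounded_seq f -> bounded_seq g ->
    E (fun j => f j + g j) = E f + E g;
  meanZ : forall c f, bounded_seq f -> E (fun j => c * f j) = c * E f;
  mean_ge : forall f c, bounded_seq f ->
    (\forall N \near \oo, c <= avg f N) -> c <= E f }.

Lemma avg_bound f C : (forall j, `|f j| <= C) -> forall N, `|avg f N| <= C.
Proof.
move=> fC N; rewrite /avg normrM normfV (ger0_norm (ler0n _ _)).
rewrite ler_pdivrMr ?ltr0n//; apply: (le_trans (ler_norm_sum _ _ _)).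
apply: (le_trans (ler_sum _ (fun j _ => fC j))).
by rewrite sumr_const_nat subSS subn0 mulr_natr.
Qed.

Lemma avgD f g N : avg (fun j => f j + g j) N = avg f N + avg g N.
Proof. by rewrite /avg big_split mulrDl. Qed.

Lemma avgZ c f N : avg (fun j => c * f j) N = c * avg f N.
Proof. by rewrite /avg -mulr_sumr mulrA. Qed.

(** Bounded averages stay in a compact segment, so they converge along any ultrafilter finer than
    [\oo]. *)
Lemma mean_exists : exists E, mean E.
Proof.
have [U [UU sub]] := @ultraFilterLemma nat \oo _.
have cv f : bounded_seq f -> cvg (avg f @ U).
  move=> [C fC].
  have UF : UltraFilter (avg f @ U).
    split => [|G PG sG]; first exact: fmap_proper_filter.
    rewrite predeqE => A; split => [GA|/sG//].
    have [//|nA] := in_ultra_setVsetC (avg f @^-1` A) UU.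
    have GnA : G (~` A) by apply: sG.
    by have [x [Ax /(_ Ax)]] := filter_ex (filterI GA GnA).
  have := @segment_compact R (- C) C; rewrite compact_ultra => /(_ _ UF) [].
    rewrite /nbhs/=; apply: filterE => N /=.
    by rewrite in_itv/= -ler_norml avg_bound.
  by move=> p [_ hp]; apply/cvg_ex; exists p.
exists (fun f => lim (avg f @ U)); split.
- move=> f g bf bg.
  rewrite (_ : avg _ = avg f + avg g); last by apply/funext => N; rewrite avgD.
  exact: limD (cv _ bf) (cv _ bg).
- move=> c f bf.
  rewrite (_ : avg _ = c *: avg f); last by apply/funext => N; rewrite avgZ.
  exact: limZr (cv _ bf).
- move=> f c bf h; apply: limr_ge; [exact: cv|exact: (sub _ h)].
Qed.

Lemma bounded_fin (T : finType) (F : T -> R) (h : nat -> T) :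
  bounded_seq (fun j => F (h j)).
Proof.
exists (\sum_t `|F t|) => j; rewrite (bigD1 (h j))//= lerDl.
exact: sumr_ge0.
Qed.

Lemma bounded_ind (P : nat -> bool) : bounded_seq (fun j => (P j)%:R).
Proof. exact: (bounded_fin (fun b : bool => b%:R) P). Qed.

Lemma bounded_cst c : bounded_seq (fun=> c).
Proof. by exists `|c|. Qed.

Lemma boundedD f g : bounded_seq f -> bounded_seq g ->
  bounded_seq (fun j => f j + g j).
Proof.
move=> [C hC] [D hD]; exists (C + D) => j.
by apply: (le_trans (ler_normD _ _)); apply: lerD.
Qed.

Lemma boundedZ c f : bounded_seq f -> bounded_seq (fun j => c * f j).
Proof.
by move=> [C hC]; exists (`|c| * C) => j; rewrite normrM ler_wpM2l.
Qed.

Lemma bounded_sum (I : Type) (s : seq I) (F : I -> nat -> R) :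
  (forall i, bounded_seq (F i)) -> bounded_seq (fun j => \sum_(i <- s) F i j).
Proof.
move=> bF; elim: s => [|i s IH].
  by exists 0 => j; rewrite big_nil normr0.
rewrite (_ : (fun j => _) = (fun j => F i j + \sum_(i <- s) F i j)).
  exact: boundedD.
by apply/funext => j; rewrite big_cons.
Qed.

Lemma bounded_shift f n : bounded_seq f -> bounded_seq (fun j => f (j + n)%N).
Proof. by move=> [C hC]; exists C => j. Qed.

Variables (E : (nat -> R) -> R) (mE : mean E).

Lemma mean0 : E (fun=> 0) = 0.
Proof.
have := meanZ mE 0 (bounded_cst 0).
by rewrite !mul0r.
Qed.

Lemma meanN f : bounded_seq f -> E (fun j => - f j) = - E f.
Proof.
move=> bf; rewrite -mulN1r -(meanZ mE)//; congr E.
by apply/funext => j; rewrite mulN1r.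
Qed.

Lemma mean_sum (I : Type) (s : seq I) (F : I -> nat -> R) :
  (forall i, bounded_seq (F i)) ->
  E (fun j => \sum_(i <- s) F i j) = \sum_(i <- s) E (F i).
Proof.
move=> bF; elim: s => [|i s IH].
  by rewrite big_nil -[RHS]mean0; congr E; apply/funext => j; rewrite big_nil.
rewrite big_cons -IH -(meanD mE)//; last exact: bounded_sum.
by congr E; apply/funext => j; rewrite big_cons.
Qed.

Lemma mean_ge0 f : bounded_seq f -> (forall j, 0 <= f j) -> 0 <= E f.
Proof.
move=> bf f0; apply: (mean_ge mE bf); apply: nearW => N.
by rewrite divr_ge0//; apply: sumr_ge0.
Qed.

Lemma mean_le f g : bounded_seq f -> bounded_seq g ->
  (forall j, f j <= g j) -> E f <= E g.
Proof.
move=> bf bg fg; rewrite -subr_ge0 -meanN// -(meanD mE)//; last first.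
  by have [C hC] := bf; exists C => j; rewrite normrN.
apply: mean_ge0 => [|j]; last by rewrite subr_ge0.
apply: boundedD => //.
by have [C hC] := bf; exists C => j; rewrite normrN.
Qed.

Lemma mean_le_cst f c : bounded_seq f ->
  (\forall N \near \oo, avg f N <= c) -> E f <= c.
Proof.
move=> bf h; rewrite -lerN2 -meanN//; apply: (mean_ge mE).
  by have [C hC] := bf; exists C => j; rewrite normrN.
near=> N; rewrite (_ : (fun j => _) = (fun j => -1 * f j)).
  by rewrite avgZ mulN1r lerN2; near: N.
by apply/funext => j; rewrite mulN1r.
Unshelve. all: by end_near.
Qed.

Lemma mean_cst c : E (fun=> c) = c.
Proof.
have avgc N : avg (fun=> c) N = c.
  by rewrite /avg sumr_const_nat subSS subn0 -[c *+ _]mulr_natr mulfK// pnatr_eq0.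
apply/eqP; rewrite eq_le; apply/andP; split.
  by apply: mean_le_cst (bounded_cst _) _; apply: nearW => N; rewrite avgc.
by apply: (mean_ge mE (bounded_cst _)); apply: nearW => N; rewrite avgc.
Qed.

Lemma mean_eq0 f : bounded_seq f ->
  (forall e, 0 < e -> \forall N \near \oo, `|avg f N| <= e) -> E f = 0.
Proof.
move=> bf h; apply/eqP; rewrite eq_le; apply/andP; split.
  apply/ler_addgt0Pr => e e0; rewrite add0r; apply: mean_le_cst => //.
  by apply: filterS (h e e0) => N; rewrite ler_norml => /andP[].
rewrite -[E f]opprK oppr_ge0.
apply/ler_addgt0Pr => e e0; rewrite add0r lerNl; apply: (mean_ge mE bf).
by apply: filterS (h e e0) => N; rewrite ler_norml => /andP[].
Qed.

(** The sums of the increments telescope and stay within [2 * C]. *)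
Lemma mean_shift1 f : bounded_seq f -> E (fun j => f j.+1) = E f.
Proof.
move=> bf; have [C hC] := bf.
have bf1 : bounded_seq (fun j => f j.+1) by exists C.
have bNf : bounded_seq (fun j => - f j) by exists C => j; rewrite normrN.
apply/eqP; rewrite -subr_eq0 -meanN// -(meanD mE)//; apply/eqP.
apply: mean_eq0 => [|e e0]; first exact: boundedD.
exists (Num.truncn (2 * C / e)).+1 => // N /= hN.
rewrite /avg (eq_bigr (fun j => f j.+1 - f j))// telescope_sumr//.
rewrite normrM normfV (ger0_norm (ler0n _ _)) ler_pdivrMr ?ltr0n//.
apply: le_trans (_ : 2 * C <= _).
  apply: (le_trans (ler_normB _ _)).
  by rewrite mulr2n mulrDl mul1r; apply: lerD.
rewrite -ler_pdivrMl// mulrC; apply: ltW; apply: lt_le_trans (truncnS_gt _) _.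
by rewrite ler_nat; apply: leq_trans hN _.
Qed.

Lemma mean_shift f n : bounded_seq f -> E (fun j => f (j + n)%N) = E f.
Proof.
move=> bf; elim: n => [|n IH].
  by congr E; apply/funext => j; rewrite addn0.
rewrite -IH -[RHS]mean_shift1; last exact: bounded_shift.
by congr E; apply/funext => j; rewrite addSnnS.
Qed.

End Mean.

(** * Entropy of finite-valued sequences *)

Section Entropy.
Set Implicit Arguments. Unset Strict Implicit. Unset Printing Implicit Defensive.
Context {R : realType}.

Lemma ln_le_subr1 (y : R) : 0 < y -> ln y <= y - 1.
Proof. by move=> y0; have := expR_ge1Dx (ln y); rewrite lnK// lerBrDl. Qed.

Lemma ln_prod (I : Type) (s : seq I) (F : I -> R) : (forall i, 0 < F i) ->
  ln (\prod_(i <- s) F i) = \sum_(i <- s) ln (F i).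
Proof.
move=> F0; elim: s => [|i s IH]; first by rewrite !big_nil ln1.
by rewrite !big_cons lnM ?posrE ?prodr_gt0// IH.
Qed.

(** Nonnegativity of relative entropy, from [ln y <= y - 1] at [y = nu t / p t]. Total mass below 1
    is allowed for [nu] because conditional laws vanish on colours of mass zero. *)
Lemma gibbs (T : finType) (p nu : T -> R) :
  (forall t, 0 <= p t) -> \sum_t p t = 1 ->
  (forall t, 0 <= nu t) -> \sum_t nu t <= 1 ->
  (forall t, 0 < p t -> 0 < nu t) ->
  \sum_t p t * ln (nu t) <= \sum_t p t * ln (p t).
Proof.
move=> p0 p1 nu0 nu1 pnu; rewrite -subr_le0 -sumrB.
apply: (@le_trans _ _ (\sum_t (nu t - p t))); last first.
  by rewrite sumrB p1 subr_le0.
apply: ler_sum => t _; have := p0 t; rewrite le_eqVlt => /predU1P[<-|pt].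
  by rewrite !mul0r !subr0.
rewrite -mulrBr -ln_div ?posrE ?pnu//.
apply: (@le_trans _ _ (p t * (nu t / p t - 1))).
  by rewrite ler_wpM2l ?ln_le_subr1 ?divr_gt0 ?pnu// ltW.
by rewrite mulrBr mulr1 mulrCA divff ?mulr1// gt_eqF.
Qed.

Lemma ler_sum_inj (T U : finType) (b : T -> U) (F : U -> R) :
  injective b -> (forall u, 0 <= F u) -> \sum_t F (b t) <= \sum_u F u.
Proof.
move=> ib F0; rewrite [leRHS](bigID (mem (b @: [set: T]%SET)))/=.
rewrite big_imset/=; last by move=> x y _ _; exact: ib.
have -> : \sum_(t in [set: T]%SET) F (b t) = \sum_t F (b t).
  by apply: eq_bigl => t; rewrite finset.in_setT.
by rewrite lerDl sumr_ge0.
Qed.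

Variables (E : (nat -> R) -> R) (mE : mean E).

Definition law (T : finType) (f : nat -> T) (t : T) : R :=
  E (fun j => (f j == t)%:R).

Definition ent (T : finType) (f : nat -> T) : R :=
  - \sum_t law f t * ln (law f t).

Definition cent (T U : finType) (f : nat -> T) (q : nat -> U) : R :=
  ent (fun j => (f j, q j)) - ent q.

Lemma law_ge0 (T : finType) (f : nat -> T) t : 0 <= law f t.
Proof. by apply: (mean_ge0 mE) => //; exact: bounded_ind. Qed.

Lemma mean_comp (T : finType) (f : nat -> T) (F : T -> R) :
  E (fun j => F (f j)) = \sum_t law f t * F t.
Proof.
rewrite (_ : (fun j => _) = fun j => \sum_t F t * (f j == t)%:R).
  rewrite mean_sum// => [|t]; last by apply: boundedZ; exact: bounded_ind.
  apply: eq_bigr => t _; rewrite mulrC.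
  by apply: (meanZ mE); exact: bounded_ind.
apply/funext => j; rewrite (bigD1 (f j))//= eqxx mulr1 big1 ?addr0// => t.
by rewrite eq_sym => /negbTE ->; rewrite mulr0.
Qed.

Lemma law_sum1 (T : finType) (f : nat -> T) : \sum_t law f t = 1.
Proof.
rewrite -[RHS](mean_cst mE 1) (mean_comp f (fun=> 1)).
by apply: eq_bigr => t _; rewrite mulr1.
Qed.

Lemma law_comp_le (T U : finType) (f : nat -> T) (phi : T -> U) t :
  law f t <= law (phi \o f) (phi t).
Proof.
apply: mean_le; rewrite //; try exact: bounded_ind.
by move=> j /=; rewrite ler_nat; case: eqP => // ->; rewrite eqxx.
Qed.

Lemma law_marginal (T U : finType) (f : nat -> T) (q : nat -> U) a :
  \sum_t law (fun j => (f j, q j)) (t, a) = law q a.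
Proof.
rewrite /law -(mean_sum mE); last by move=> t; exact: bounded_ind.
congr E; apply/funext => j; rewrite (bigD1 (f j))//= xpair_eqE eqxx /=.
rewrite big1 ?addr0// => t /negbTE ft.
by rewrite xpair_eqE eq_sym ft.
Qed.

Lemma law_shift (T : finType) (f : nat -> T) n :
  law (fun j => f (j + n)%N) = law f.
Proof.
apply/funext => t; apply: (mean_shift mE n (f := fun j => (f j == t)%:R)).
exact: bounded_ind.
Qed.

(** Each value of [f] has at most the mass of its image, and [ln] is increasing. *)
Lemma ent_comp_le (T U : finType) (f : nat -> T) (phi : T -> U) :
  ent (phi \o f) <= ent f.
Proof.
rewrite lerN2.
rewrite -(mean_comp (phi \o f) (fun u => ln (law (phi \o f) u))).
rewrite (mean_comp f (fun t => ln (law (phi \o f) (phi t)))).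
apply: ler_sum => t _; have := law_ge0 f t.
rewrite le_eqVlt => /predU1P[<-|ft]; first by rewrite !mul0r.
apply: ler_wpM2l; first exact: ltW.
by rewrite ler_ln ?posrE ?law_comp_le// (lt_le_trans ft (law_comp_le _ _ _)).
Qed.

(** Written as a mean along time, conditional entropy can be moved from block to block by shift
    invariance. *)
Lemma centE (T U : finType) (f : nat -> T) (q : nat -> U) :
  cent f q = - E (fun j => ln (law (fun j => (f j, q j)) (f j, q j)) -
                           ln (law q (q j))).
Proof.
rewrite /cent /ent -(mean_comp _ (fun u => ln (law q u))).
rewrite -(mean_comp (fun j => (f j, q j))
  (fun u => ln (law (fun j => (f j, q j)) u))).
have b1 : bounded_seq (fun j => ln (law (fun j => (f j, q j)) (f j, q j))).
  exact: (bounded_fin (fun u => ln (law (fun j => (f j, q j)) u))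
    (fun j => (f j, q j))).
have b2 : bounded_seq (fun j => ln (law q (q j))).
  exact: (bounded_fin (fun u => ln (law q u)) q).
have b3 : bounded_seq (fun j => - ln (law q (q j))).
  by have [C hC] := b2; exists C => j; rewrite normrN.
by rewrite (meanD mE b1 b3) (meanN mE b2) opprB opprK addrC.
Qed.

Variables (k : nat) (l : nat -> 'I_k).

Definition word n (j : nat) : {ffun 'I_n -> 'I_k} :=
  [ffun i : 'I_n => l (j + i)%N].

Lemma block_idx_subproof r n (i : 'I_r) (m : 'I_n) : (i * n + m < r * n)%N.
Proof.
apply: leq_trans (_ : i * n + n <= _)%N; first by rewrite ltn_add2l.
by rewrite addnC -mulSn leq_mul2r ltn_ord orbT.
Qed.

Definition block r n (w : {ffun 'I_(r * n) -> 'I_k}) :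
    {ffun 'I_r -> {ffun 'I_n -> 'I_k}} :=
  [ffun i => [ffun m => w (Ordinal (block_idx_subproof i m))]].

Lemma block_inj r n : injective (@block r n).
Proof.
move=> w w' /ffunP ww; apply/ffunP => x.
have n0 : (0 < n)%N by case: n w w' ww x => // w w' ww [x]; rewrite muln0.
have hi : (x %/ n < r)%N by rewrite ltn_divLR.
have hm : (x %% n < n)%N by rewrite ltn_mod.
have := ww (Ordinal hi); rewrite !ffunE => /ffunP/(_ (Ordinal hm)).
rewrite !ffunE; rewrite (_ : Ordinal _ = x)//.
by apply: val_inj => /=; rewrite -divn_eq.
Qed.

Lemma block_word r n j (i : 'I_r) : block (word (r * n) j) i = word n (j + i * n)%N.
Proof. by apply/ffunP => m; rewrite !ffunE addnA. Qed.

Lemma ent_word_le m n : (m <= n)%N -> ent (word m) <= ent (word n).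
Proof.
move=> mn; rewrite (_ : word m = (fun w : {ffun 'I_n -> 'I_k} =>
  [ffun i : 'I_m => w (widen_ord mn i)]) \o word n); first exact: ent_comp_le.
by apply/funext => j; apply/ffunP => i /=; rewrite !ffunE.
Qed.

(* If [G j] determines the colours of the starting points of the [r] blocks,
   coding a word by [G j] and then each block by its colour is a code for
   [word (r * n)]. *)
Lemma ent_word_block (T Q : finType) (q : nat -> Q) (G : nat -> T) r n :
  (forall j j', G j = G j' -> forall i, (i < r)%N ->
     q (j + i * n)%N = q (j' + i * n)%N) ->
  ent (word (r * n)) <= ln #|T|%:R + r%:R * cent (word n) q.
Proof.
move=> Gq.
(* The colour of block [i] is read off any time at which [G] takes the value [t]; a value never
   taken gets the default time 0. *)
pose phi i t := q (xget 0%N [set j | G j = t] + i * n)%N.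
have phiE j i : (i < r)%N -> q (j + i * n)%N = phi i (G j).
  move=> ir; apply: Gq => //; apply/esym.
  exact: (@xgetPex _ 0%N [set j' | G j' = G j] (ex_intro _ j erefl)).
pose pr := law (fun j => (word n j, q j)).
(* The conditional probability of [w] given the colour [a], equal to 0 when [a] has mass 0. *)
pose c w a := pr (w, a) / law q a.
have c0 w a : 0 <= c w a by rewrite divr_ge0 ?law_ge0.
have c1 a : \sum_w c w a <= 1.
  rewrite -mulr_suml law_marginal; have [->|q0] := eqVneq (law q a) 0.
    by rewrite mul0r.
  by rewrite divff.
have T0 : 0 < #|T|%:R :> R by rewrite ltr0n; apply/card_gt0P; exists (G 0%N).
pose wG j := (word (r * n) j, G j).
(* The code: a uniform value of [G], then independent blocks, each drawn given its colour. *)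
pose nu (u : {ffun 'I_(r * n) -> 'I_k} * T) : R :=
  #|T|%:R^-1 * \prod_(i < r) c (block u.1 i) (phi i u.2).
have nu0 u : 0 <= nu u.
  by rewrite mulr_ge0 ?invr_ge0 ?prodr_ge0// ltW.
have nu1 : \sum_u nu u <= 1.
  rewrite -mulr_sumr ler_pdivrMl// mulr1.
  rewrite -(pair_bigA _ (fun w t => \prod_(i < r) c (block w i) (phi i t)))/=.
  rewrite exchange_big/= -sum1_card natr_sum; apply: ler_sum => t _.
  (* Splitting into blocks is injective, so the sum over words is at most the sum over all tuples of
     blocks, which factors. *)
  apply: le_trans (@ler_sum_inj _ _ (@block r n)
    (fun v => \prod_(i < r) c (v i) (phi i t)) (@block_inj r n) _) _.
    by move=> u; rewrite prodr_ge0.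
  rewrite -(bigA_distr_bigA (fun (i : 'I_r) w => c w (phi i t)))/=.
  by apply: numdomain.Num.Theory.prodr_ile1 => i _; rewrite c1 sumr_ge0.
have pos u (i : 'I_r) : 0 < law wG u -> 0 < pr (block u.1 i, phi i u.2).
  move=> wGu; apply: lt_le_trans wGu _.
  rewrite /pr -(law_shift (fun j => (word n j, q j)) (i * n)).
  apply: mean_le => //; try exact: bounded_ind.
  move=> j; rewrite ler_nat; case: (wG j =P u) => // <- /=.
  by rewrite block_word -phiE// eqxx.
have posq u (i : 'I_r) : 0 < law wG u -> 0 < law q (phi i u.2).
  move=> /(pos _ i) h; apply: lt_le_trans h _.
  exact: (law_comp_le (fun j => (word n j, q j)) snd).
apply: (@le_trans _ _ (ent wG)); first exact: (ent_comp_le wG fst).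
have gb := gibbs (law_ge0 wG) (law_sum1 wG) nu0 nu1.
apply: (@le_trans _ _ (- \sum_u law wG u * ln (nu u))).
  rewrite lerN2; apply: gb => u wGu.
  rewrite mulr_gt0 ?invr_gt0// prodr_gt0// => i _.
  by rewrite divr_gt0 ?pos ?posq.
pose L (i : 'I_r) (u : {ffun 'I_(r * n) -> 'I_k} * T) : R :=
  ln (pr (block u.1 i, phi i u.2)) - ln (law q (phi i u.2)).
have -> : \sum_u law wG u * ln (nu u) =
    \sum_u law wG u * (- ln #|T|%:R + \sum_(i < r) L i u).
  apply: eq_bigr => u _; have := law_ge0 wG u.
  rewrite le_eqVlt => /predU1P[<-|wGu]; first by rewrite !mul0r.
  have cpos (i : 'I_r) : 0 < c (block u.1 i) (phi i u.2).
    by rewrite divr_gt0 ?pos ?posq.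
  congr (_ * _); rewrite lnM ?posrE ?invr_gt0 ?prodr_gt0// lnV ?posrE//.
  congr (_ + _); rewrite ln_prod//.
  by apply: eq_bigr => i _; rewrite ln_div ?posrE ?pos ?posq.
under eq_bigr do rewrite mulrDr mulr_sumr.
rewrite big_split/= -mulr_suml law_sum1 mul1r opprD opprK lerD2l.
rewrite exchange_big/= -sumrN.
rewrite (eq_bigr (fun=> cent (word n) q)) ?sumr_const ?card_ord ?mulr_natl// => i _.
rewrite -(mean_comp wG (L i)) centE; congr (- _).
have bL : bounded_seq (fun j => ln (pr (word n j, q j)) - ln (law q (q j))).
  exact: (bounded_fin (fun u => ln (pr u) - ln (law q u.2))
    (fun j => (word n j, q j))).
rewrite -[RHS](mean_shift mE (i * n) bL).
by congr E; apply/funext => j; rewrite /L block_word -phiE.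
Qed.

End Entropy.

(** * Mutual information of words and colours *)

Section Information.
Set Implicit Arguments. Unset Strict Implicit. Unset Printing Implicit Defensive.
Context {R : realType} (E : (nat -> R) -> R) (mE : mean E).

(** After exponentiation, [1 + x^2 / 2 <= exp x] would, for positive [d], bound a quadratic in [r]
    by a linear function. *)
Lemma le0_linear_le_ln (M : nat) (d : R) :
  (forall r, r%:R * d <= ln (M * r.+1)%:R) -> d <= 0.
Proof.
move=> h; rewrite leNgt; apply/negP => d0.
have key r : r.+1%:R * d ^+ 2 <= 4 * M%:R.
  have := h r.+1; case: M {h} => [|M]; first by rewrite mul0n ln0// leNgt mulr_gt0.
  rewrite -ler_expR lnK ?posrE ?ltr0n// => h.
  have := expR_ge1Dxn 1 (ltW (mulr_gt0 (ltr0Sn R r) d0)).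
  move=> /le_trans/(_ h); rewrite natrM.
  rewrite (_ : 2`!%:R = 2)// exprMn.
  have : r.+2%:R <= 2 * r.+1%:R :> R.
    by rewrite -natrM ler_nat mul2n -addnn addSn ltnS leq_addl.
  move: (ltr0Sn R r); set x : R := r.+1%:R; set y : R := r.+2%:R.
  move=> x0 yx h1; have M0 := ltr0Sn R M; move: h1 M0; set m : R := M.+1%:R => h1 m0.
  have h2 : m * y <= m * (2 * x) by rewrite ler_pM2l.
  rewrite -(ler_pM2l x0); nra.
have := key (Num.truncn (4 * M%:R / d ^+ 2)).
rewrite leNgt -ltr_pdivrMr ?exprn_gt0//.
by rewrite truncnS_gt.
Qed.

Lemma ent_ge0 (T : finType) (f : nat -> T) : 0 <= ent E f.
Proof.
rewrite /ent -sumrN; apply: sumr_ge0 => t _; rewrite -mulrN mulr_ge0 ?law_ge0//.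
rewrite oppr_ge0 ln_le0// -(law_sum1 mE f) (bigD1 t)//= lerDl.
by apply: sumr_ge0 => u _; exact: law_ge0.
Qed.

Variables (k : nat) (l : nat -> 'I_k).

(** Subadditivity, from [ent_word_block] with a constant colouring: the blocks of length [n1] that
    cover a word of length [n] overshoot it by at most [n1]. *)
Lemma ent_word_ub n1 (g : R) n : (0 < n1)%N -> 0 <= g ->
  ent E (word l n1) <= n1%:R * g -> ent E (word l n) <= (n + n1)%:R * g.
Proof.
move=> n10 g0 h; set r := (n %/ n1).+1.
have nr : (n <= r * n1)%N by rewrite ltnW// ltn_ceil.
apply: le_trans (ent_word_le mE l nr) _.
have := @ent_word_block _ _ mE _ l unit unit (fun=> tt) (fun=> tt) r n1.
move=> /(_ (fun _ _ _ _ _ => erefl)); rewrite card_unit ln1 add0r.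
move=> /le_trans; apply; apply: le_trans (_ : r%:R * ent E (word l n1) <= _).
  rewrite ler_wpM2l// lerBlDr; apply: le_trans (_ : ent E (word l n1) <= _).
    exact: (ent_comp_le mE (word l n1) (fun w => (w, tt))).
  by rewrite lerDl ent_ge0.
apply: le_trans (_ : r%:R * (n1%:R * g) <= _); first by rewrite ler_wpM2l.
rewrite mulrA -natrM ler_wpM2r// ler_nat mulSn addnC leq_add2r.
exact: leq_trunc_div.
Qed.

(** Over [r] blocks the colours cost only [ln (M * r.+1)], so [r] times the deficit of the
    conditional entropy grows at most logarithmically, and the deficit cannot be positive. *)
Lemma cent_word_lb (Q : finType) (q : nat -> Q) (M n : nat) (h : R) :
  (forall N, N%:R * h <= ent E (word l N)) ->
  (forall r, exists (T : finType) (G : nat -> T), (#|T| <= M * r.+1)%N /\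
     forall j j', G j = G j' -> forall i, (i < r)%N ->
     q (j + i * n)%N = q (j' + i * n)%N) ->
  n%:R * h <= cent E (word l n) q.
Proof.
move=> hh hG; rewrite -subr_le0; apply: (@le0_linear_le_ln M) => r.
have [T [G [cT GT]]] := hG r.
have := ent_word_block mE l GT; have := hh (r * n)%N.
have T0 : (0 < #|T|)%N by apply/card_gt0P; exists (G 0%N).
have : ln #|T|%:R <= ln (M * r.+1)%:R :> R.
  by rewrite ler_ln ?posrE ?ltr0n// ?ler_nat// (leq_trans T0).
rewrite natrM; lra.
Qed.

Section BadPairs.
Variables (T Q : finType) (f : nat -> T) (q : nat -> Q) (Lam : R).
Hypothesis Lam0 : 0 < Lam.

Definition good_pair (u : T * Q) : bool :=
  law E (fun j => (f j, q j)) u <= Lam * (law E f u.1 * law E q u.2).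

(** A Markov bound. Mutual information is the mean of the logarithm of the joint law over the
    product law; this exceeds [ln Lam] on bad pairs, and by [ln y <= y - 1] the good pairs lower the
    total by at most 1. *)
Lemma bad_mass :
  E (fun j => (~~ good_pair (f j, q j))%:R) * ln Lam <=
  ent E f - cent E f q + 1.
Proof.
set pr := law E (fun j => (f j, q j)).
rewrite (mean_comp mE (fun j => (f j, q j)) (fun u => (~~ good_pair u)%:R)).
have entf : ent E f = - \sum_u pr u * ln (law E f u.1).
  rewrite /ent; congr (- _).
  by rewrite -(mean_comp mE f (fun t => ln (law E f t)))
    -(mean_comp mE (fun j => (f j, q j)) (fun u => ln (law E f u.1))).
rewrite centE// (mean_comp mE (fun j => (f j, q j))
  (fun u => ln (pr u) - ln (law E q u.2))) entf opprK.
have s1 : \sum_u law E f u.1 * law E q u.2 = 1.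
  rewrite -(pair_bigA _ (fun w t => law E f w * law E q t))/=.
  by under eq_bigr do rewrite -mulr_sumr law_sum1// mulr1; rewrite law_sum1.
(* The summand 1 is spread over the pairs as the product law, to compare term by term. *)
rewrite -[X in _ <= _ + X]s1 mulr_suml -sumrN -!big_split/=; apply: ler_sum => u _.
have w0 : 0 <= law E f u.1 * law E q u.2 by rewrite mulr_ge0 ?law_ge0.
have := law_ge0 mE (fun j => (f j, q j)) u; rewrite -/pr le_eqVlt.
move=> /predU1P[<-|pr0]; first by rewrite !mul0r oppr0 !add0r.
have pf : 0 < law E f u.1.
  exact: lt_le_trans pr0 (law_comp_le mE (fun j => (f j, q j)) fst u).
have pq : 0 < law E q u.2.
  exact: lt_le_trans pr0 (law_comp_le mE (fun j => (f j, q j)) snd u).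
rewrite -mulrN -mulrDr.
have -> : - ln (law E f u.1) + (ln (pr u) - ln (law E q u.2)) =
    ln (pr u / (law E f u.1 * law E q u.2)).
  by rewrite ln_div ?posrE ?mulr_gt0// lnM ?posrE//; ring.
case: (boolP (good_pair u)) => /= gu.
  rewrite mulr0 mul0r.
  have := ln_le_subr1 (divr_gt0 (mulr_gt0 pf pq) pr0).
  rewrite -[X in ln X]invf_div lnV ?posrE ?divr_gt0 ?mulr_gt0// => h.
  have := ler_wpM2l (ltW pr0) h.
  rewrite mulrBr mulr1 mulrCA divff ?gt_eqF// mulr1 mulrN; lra.
rewrite mulr1 -[leLHS]addr0 lerD// ler_pM2l//.
rewrite ler_ln ?posrE ?divr_gt0 ?mulr_gt0// ler_pdivlMr ?mulr_gt0//.
by move: gu; rewrite /good_pair -ltNge => /ltW.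
Qed.
End BadPairs.
End Information.

(** * Covering by few random choices *)

Section Cover.
Set Implicit Arguments. Unset Strict Implicit. Unset Printing Implicit Defensive.
Context {R : realType}.

(** Serves to bound [t * (1 - t) ^+ M] by [1 / M]. *)
Lemma pow_1B_mul_le1 (t : R) M : 0 <= t <= 1 -> (1 - t) ^+ M * (1 + M%:R * t) <= 1.
Proof.
move=> /andP[t0 t1]; elim: M => [|M IH]; first by rewrite expr0 mul0r addr0 mulr1.
apply: le_trans IH; rewrite exprSr -mulrA ler_wpM2l ?exprn_ge0 ?subr_ge0//.
have : 0 <= M%:R :> R by [].
rewrite -natr1; move: (M%:R : R) => m m0; nra.
Qed.

(* Random choice: the expectation of the uncovered mass when [M] words are
   drawn independently with law [p] is the right-hand side. *)
Lemma cover_pow (T Q : finType) (p : T -> R) (c : T -> Q -> bool) (b : Q -> R) M :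
  (forall t, 0 <= p t) -> \sum_t p t = 1 -> (forall a, 0 <= b a) ->
  exists Ms : {set T}, (#|Ms| <= M)%N /\
    \sum_(a | ~~ [exists w in Ms, c w a]) b a <=
    \sum_a b a * (1 - \sum_(w | c w a) p w) ^+ M.
Proof.
move=> p0 p1; elim: M b => [|M IH] b b0.
  exists finset.set0; rewrite cards0; split => //.
  under [leRHS]eq_bigr do rewrite expr0 mulr1.
  by rewrite [leRHS](bigID (fun a => ~~ [exists w in finset.set0, c w a]))/=
    lerDl sumr_ge0.
set tau := fun a => \sum_(w | c w a) p w.
(* The mass left uncovered once [w] is drawn. *)
pose bw w a := b a * (~~ c w a)%:R.
pose F w := \sum_a bw w a * (1 - tau a) ^+ M.
pose rhs := \sum_a b a * (1 - tau a) ^+ M.+1.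
have mF : \sum_w p w * F w = rhs.
  under eq_bigr do rewrite mulr_sumr.
  rewrite exchange_big/=; apply: eq_bigr => a _.
  have e : 1 - tau a = \sum_(w | ~~ c w a) p w.
    by apply/eqP; rewrite subr_eq -p1 addrC; apply/eqP; exact: bigID.
  rewrite exprS [RHS]mulrA {2}e.
  rewrite mulr_sumr mulr_suml [RHS]big_mkcond/=; apply: eq_bigr => w _.
  by rewrite /bw; case: (c w a) => /=; rewrite ?(mulr0, mul0r)// mulr1; ring.
(* Some first word does at least as well as the average over the first draw. *)
have [w Fw] : exists w, F w <= rhs.
  apply/not_existsP => h.
  have hp w : 0 <= p w * (F w - rhs).
    by rewrite mulr_ge0// subr_ge0 leNgt; apply/negP => /ltW /h.
  have s0 : \sum_w p w * (F w - rhs) = 0.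
    under eq_bigr do rewrite mulrBr.
    by rewrite sumrB mF -mulr_suml p1 mul1r subrr.
  have := psumr_eq0P (fun w _ => hp w) s0 => pF.
  have : \sum_w p w = 0.
    apply: big1 => w _; have /eqP := pF w isT.
    rewrite mulf_eq0 => /orP[/eqP//|/eqP Fr]; exfalso; apply: (h w).
    by rewrite -subr_le0 Fr.
  by rewrite p1 => /eqP; rewrite oner_eq0.
have [|Ms [cMs hMs]] := IH (bw w); first by move=> a; rewrite mulr_ge0.
exists (w |: Ms)%SET; split; first by rewrite cardsU1 -add1n leq_add// leq_b1.
apply: le_trans Fw; apply: le_trans hMs.
rewrite big_mkcond [leRHS]big_mkcond/=; apply: ler_sum => a _.
case: (boolP [exists _ in (w |: Ms)%SET, _]) => /= [_|nw].
  by case: ifP => // _; rewrite mulr_ge0.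
have -> : [exists w0 in Ms, c w0 a] = false.
  apply/negbTE; apply: contra nw => /existsP[v /andP[vM cv]].
  by apply/existsP; exists v; rewrite !inE vM orbT.
have cwa : c w a = false.
  apply/negbTE; apply: contra nw => cw.
  by apply/existsP; exists w; rewrite !inE eqxx.
by rewrite /bw cwa mulr1.
Qed.

(** A cell hit by a random word with probability [t] has mass at most [Lam * p' a * t] and is missed
    with probability [(1 - t) ^+ M]; the product is at most [Lam * p' a / M], whatever the number of
    cells. *)
Lemma cover_mass (T Q : finType) (p : T -> R) (p' b : Q -> R) (c : T -> Q -> bool)
    (Lam : R) M :
  (forall t, 0 <= p t) -> \sum_t p t = 1 ->
  (forall a, 0 <= p' a) -> \sum_a p' a = 1 ->
  (forall a, 0 <= b a) -> 0 <= Lam -> (0 < M)%N ->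
  (forall a, b a <= Lam * p' a * \sum_(w | c w a) p w) ->
  exists Ms : {set T}, (#|Ms| <= M)%N /\
    \sum_(a | ~~ [exists w in Ms, c w a]) b a <= Lam / M%:R.
Proof.
move=> p0 p1 p'0 p'1 b0 L0 M0 hb.
have [Ms [cM hM]] := cover_pow c M p0 p1 b0.
exists Ms; split => //; apply: (le_trans hM).
rewrite -[leRHS]mulr1 -[X in _ <= _ * X]p'1 mulr_sumr; apply: ler_sum => a _.
set t := \sum_(w | c w a) p w.
have t01 : 0 <= t <= 1.
  rewrite sumr_ge0//= -p1 /t [leLHS]big_mkcond; apply: ler_sum => w _.
  by case: ifP.
have m0 : 0 < M%:R :> R by rewrite ltr0n.
apply: (@le_trans _ _ (Lam * p' a * t * (1 - t) ^+ M)).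
  apply: ler_wpM2r; last exact: hb.
  by rewrite exprn_ge0// subr_ge0; case/andP: t01.
rewrite -mulrA [leRHS]mulrAC; apply: ler_wpM2l; first exact: mulr_ge0.
rewrite -[leRHS]mul1r ler_pdivlMr//.
apply: le_trans (pow_1B_mul_le1 M t01).
case/andP: t01 => t0 t1; have : 0 <= (1 - t) ^+ M by rewrite exprn_ge0 ?subr_ge0.
move: ((1 - t) ^+ M) => z z0; lra.
Qed.

End Cover.

(** * Cells of the rotation *)

Section Rotation.
Set Implicit Arguments. Unset Strict Implicit. Unset Printing Implicit Defensive.
Context {R : realType}.
Variable alpha : R.

(* The index [c] such that the fractional part of [j * alpha] lies in
   [[c / m.+1, (c + 1) / m.+1)]; see [cell_fracpart]. *)
Definition cell (m j : nat) : 'I_m.+1 :=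
  inord `|(Num.floor (m.+1%:R * (j%:R * alpha)) %% m.+1)%Z|%N.

Lemma cellP m j : exists z : int,
  Num.floor (m.+1%:R * (j%:R * alpha)) = z * m.+1%:Z + (cell m j)%:Z.
Proof.
set F := Num.floor _; exists (F %/ m.+1)%Z.
rewrite /cell inordK; last first.
  by rewrite -ltz_nat gez0_abs ?modz_ge0// ltz_pmod.
by rewrite gez0_abs ?modz_ge0// -divz_eq.
Qed.

Lemma cell_eq m j (z : int) (c : 'I_m.+1) :
  Num.floor (m.+1%:R * (j%:R * alpha)) = z * m.+1%:Z + c%:Z -> cell m j = c.
Proof.
move=> h; apply: val_inj; rewrite /cell h modzMDl /=.
by rewrite modz_small ?ltz_nat//= inordK.
Qed.

Lemma cell_itv m j : exists z : int,
  z%:~R + (cell m j)%:R / m.+1%:R <= j%:R * alpha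
    < z%:~R + (cell m j).+1%:R / m.+1%:R.
Proof.
have [z hz] := cellP m j; exists z.
have m0 : 0 < m.+1%:R :> R by rewrite ltr0n.
have := floor_itv (m.+1%:R * (j%:R * alpha)); rewrite hz.
have e (c : R) : m.+1%:R * (z%:~R + c / m.+1%:R) = z%:~R * m.+1%:R + c.
  by field; rewrite gt_eqF.
rewrite !(intrD, intrM) -!pmulrn => /andP[h1 h2].
rewrite -(ler_pM2l m0) -[X in _ && X](ltr_pM2l m0) !e h1/=.
by rewrite -[(cell m j).+1%:R]natr1 addrA.
Qed.

Lemma cell_fracpart m j :
  (cell m j)%:R / m.+1%:R <= fracpart (j%:R * alpha)
    < (cell m j).+1%:R / m.+1%:R.
Proof.
have [z /andP[h1 h2]] := cell_itv m j.
have m0 : 0 < m.+1%:R :> R by rewrite ltr0n.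
rewrite /fracpart (_ : Num.floor _ = z).
  by rewrite lerBrDl h1 ltrBlDl.
apply/eqP; rewrite floor_eq intrD; apply/andP; split.
  by apply: le_trans h1; rewrite lerDl divr_ge0.
apply: (lt_le_trans h2); rewrite lerD2l ler_pdivrMr// mul1r ler_nat.
exact: ltn_ord.
Qed.

Lemma floorD_carry (x y : R) : Num.floor (x + y) = Num.floor x + Num.floor y +
  (nat_of_bool (1 - fracpart y <= fracpart x))%:Z.
Proof.
apply/eqP; rewrite floor_eq !intrD !mulr1z -pmulrn /fracpart.
have := floor_itv x; have := floor_itv y; rewrite !intrD !mulr1z.
move=> /andP[y1 y2] /andP[x1 x2].
by case: (lerP (1 - (y - _)) (x - _)) => /= h; apply/andP; split; lra.
Qed.

(* The carries at the times [i * n], [i < r], are the indicators of nested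
   half-lines at the fractional part of [m.+1 * (j * alpha)], so their number
   determines all of them. *)
Lemma cell_code m n r : exists (T : finType) (G : nat -> T),
  (#|T| <= m.+1 * r.+1)%N /\
  forall j j', G j = G j' -> forall i, (i < r)%N ->
    cell m (j + i * n) = cell m (j' + i * n).
Proof.
pose v j := fracpart (m.+1%:R * (j%:R * alpha)).
pose th i := 1 - fracpart (m.+1%:R * ((i * n)%:R * alpha)).
pose cnt j : {set 'I_r} := [set i : 'I_r | th i <= v j]%SET.
have cntr j : (#|cnt j| < r.+1)%N.
  by rewrite ltnS (leq_trans (max_card _))// card_ord.
exists ('I_m.+1 * 'I_r.+1)%type, (fun j => (cell m j, Ordinal (cntr j))).
rewrite card_prod !card_ord; split => // j j' [cjj cc] i ir.
have cE : cnt j = cnt j'.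
  have [vv|/ltW vv] := leP (v j) (v j').
    apply/eqP; rewrite eqEcard cc leqnn andbT; apply/fintype.subsetP => x.
    by rewrite !inE => /le_trans; apply.
  apply/esym/eqP; rewrite eqEcard cc leqnn andbT; apply/fintype.subsetP => x.
  by rewrite !inE => /le_trans; apply.
have fE t : Num.floor (m.+1%:R * ((t + i * n)%:R * alpha)) =
  Num.floor (m.+1%:R * (t%:R * alpha)) +
  Num.floor (m.+1%:R * ((i * n)%:R * alpha)) +
  (nat_of_bool (Ordinal ir \in cnt t))%:Z.
  by rewrite natrD mulrDl mulrDr floorD_carry inE.
have [z1 h1] := cellP m (j' + i * n); have [z2 h2] := cellP m j.
have [z3 h3] := cellP m j'.
(* Both positions receive the same increment and carry, so their floors still differ by a multiple
   of [m.+1]. *)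
apply: (@cell_eq _ _ (z1 + z2 - z3)).
have := fE j'; rewrite h1 h3 fE cE h2 cjj mulrBl mulrDl; lra.
Qed.

Hypothesis ir : irrational alpha.

Lemma irrational_mul_neq (d : nat) (z : int) : (0 < d)%N -> d%:R * alpha != z%:~R.
Proof.
move=> d0; apply/negP => /eqP h; apply: ir; apply/rationalP; exists z, d.
by rewrite -h mulrAC divff ?mul1r// pnatr_eq0 -lt0n.
Qed.

(** Dirichlet's pigeonhole: two of [Q.+2] multiples share one of [Q.+1] cells, and irrationality
    keeps their difference off the integers. *)
Lemma small_multiple (Q : nat) : exists (d : nat) (z : int),
  (0 < d)%N /\ 0 < `|d%:R * alpha - z%:~R| < Q.+1%:R^-1.
Proof.
have : ~~ injectiveb (fun i : 'I_Q.+2 => cell Q i).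
  by apply/injectiveP => /leq_card; rewrite !card_ord ltnn.
case/injectivePn => i [j]; wlog ij : i j / (i < j)%N.
  move=> W ne; have := ne; rewrite neq_ltn => /orP[] lt e.
    by apply: (W i j).
  by apply: (W j i) => //; rewrite eq_sym.
move=> _ ce; have [z1 /andP[a1 a2]] := cell_itv Q i.
have [z2 /andP[b1 b2]] := cell_itv Q j.
have d0 : (0 < j - i)%N by rewrite subn_gt0.
exists (j - i)%N, (z2 - z1); split => //; apply/andP; split.
  by rewrite normr_gt0 subr_eq0 irrational_mul_neq.
rewrite natrB ?(ltnW ij)// intrB ltr_norml; move: a1 a2 b1 b2.
rewrite -ce -!natr1 !mulrDl !mul1r; move: (_^-1) => v; lra.
Qed.

(* The first [m] translates of a cell of length [1 / m.+1] by multiples of such a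
   step are disjoint. *)
Lemma rotation_step m : (1 < m)%N -> exists (t : nat) (z : int),
  m.+1%:R^-1 <= `|t%:R * alpha - z%:~R| <= m%:R^-1.
Proof.
(* The step found is shorter than [1 / m - 1 / m.+1], so its first multiple beyond [1 / m.+1] does
   not pass [1 / m]. *)
move=> m1; have [d [z [d0 /andP[n0 n1]]]] := small_multiple (m * m.+1).
set y := `|_| in n0 n1.
pose s := (Num.truncn (m.+1%:R^-1 / y)).+1.
have m0 : 0 < m%:R :> R by rewrite ltr0n ltnW.
have m0' : 0 < m.+1%:R :> R by rewrite ltr0n.
have q0 : 0 <= m.+1%:R^-1 / y by rewrite divr_ge0 ?invr_ge0// ltW.
have /andP[s1 s2] := truncn_itv q0.
exists (s * d)%N, (z * s%:Z).
rewrite natrM -mulrA intrM -pmulrn [_ * s%:R]mulrC -mulrBr.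
rewrite normrM ger0_norm// -/y; apply/andP; split.
  by rewrite -ler_pdivrMr//; apply: ltW.
have e : m%:R^-1 - m.+1%:R^-1 = (m * m.+1)%:R^-1 :> R.
  by rewrite natrM -natr1; field; rewrite natr1 !gt_eqF.
rewrite ler_pdivlMr// in s1.
rewrite /s -[X in X * y]natr1 mulrDl mul1r addrC -lerBrDr.
apply: le_trans (_ : (m * m.+1)%:R^-1 <= _).
  apply: ltW; apply: lt_trans n1 _.
  rewrite ltf_pV2 ?posrE ?ltr0n ?muln_gt0 ?(ltnW m1)//.
  by rewrite ltr_nat.
by rewrite -e lerD2l lerN2.
Qed.

(** At most one of the [m] times [j + i * t] falls in the cell, and by shift invariance these visits
    all have the same mean. *)
Lemma cell_law (E : (nat -> R) -> R) (mE : mean E) m (c : 'I_m.+1) :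
  (1 < m)%N -> m%:R * law E (cell m) c <= 1.
Proof.
move=> m1; have [t [z /andP[t1 t2]]] := rotation_step m1.
rewrite -[leRHS](mean_cst mE 1).
have -> : m%:R * law E (cell m) c =
    E (fun j => \sum_(i < m) (cell m (j + i * t) == c)%:R).
  rewrite (mean_sum mE); last by move=> i; exact: bounded_ind.
  rewrite (eq_bigr (fun=> law E (cell m) c)).
    by rewrite sumr_const card_ord mulr_natl.
  by move=> i _; rewrite -[in RHS](law_shift mE (cell m) (i * t)).
apply: (mean_le mE).
- by apply: bounded_sum => i; exact: bounded_ind.
- exact: bounded_cst.
move=> j; case: (pickP (fun i : 'I_m => cell m (j + i * t) == c)) => [i0 hi0|h].
  rewrite (bigD1 i0)//= hi0 big1 ?addr0// => i ii0.
  case: eqP => // hi; exfalso; move/eqP: hi0 => hi0.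
  wlog lt : i i0 ii0 hi hi0 / (i < i0)%N.
    move=> W; have := ii0; rewrite neq_ltn => /orP[] lt.
      exact: (W i i0).
    by apply: (W i0 i) => //; rewrite eq_sym.
  have [z1 /andP[a1 a2]] := cell_itv m (j + i * t).
  have [z2 /andP[b1 b2]] := cell_itv m (j + i0 * t).
  pose d := (i0 - i)%N.
  have d0 : (0 < d)%N by rewrite subn_gt0.
  have dm : (d.+1 <= m)%N by rewrite (leq_trans _ (ltn_ord i0))// ltnS leq_subr.
  pose y := t%:R * alpha - z%:~R.
  pose w := z2 - z1 - z * d%:Z.
  have m0 : 0 < m%:R :> R by rewrite ltr0n ltnW.
  have m0' : 0 < m.+1%:R :> R by rewrite ltr0n.
  (* Two visits would put [d * y] within [1 / m.+1] of the integer [w], yet its absolute value lies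
     between [1 / m.+1] and [1 - 1 / m.+1]. *)
  have dy : `|d%:R * y - w%:~R| < m.+1%:R^-1.
    have -> : d%:R * y - w%:~R =
        ((j + i0 * t)%:R * alpha - z2%:~R) - ((j + i * t)%:R * alpha - z1%:~R).
      rewrite /y /w !intrB intrM -pmulrn /d natrB ?(ltnW lt)// !natrD !natrM.
      by ring.
    rewrite ltr_norml; move: a1 a2 b1 b2.
    rewrite hi hi0 -!natr1 !mulrDl !mul1r.
    by move: (_^-1) => v; lra.
  have dy1 : m.+1%:R^-1 <= `|d%:R * y|.
    rewrite normrM ger0_norm// (le_trans t1)// -/y ler_peMl//.
    by rewrite ler1n.
  have dy2 : `|d%:R * y| <= 1 - m.+1%:R^-1.
    rewrite normrM ger0_norm//; apply: le_trans (_ : d%:R / m%:R <= _).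
      by rewrite ler_wpM2l.
    apply: le_trans (_ : 1 - m%:R^-1 <= _).
      rewrite -subr_ge0 (_ : _ - _ = (m%:R - d.+1%:R) / m%:R).
        by rewrite divr_ge0 ?subr_ge0 ?ler_nat.
      by rewrite -natr1; field; rewrite gt_eqF.
    rewrite lerD2l lerN2 lef_pV2 ?posrE//.
    by rewrite ler_nat.
  have [w0|w0] := eqVneq w 0; first by move: dy; rewrite w0 subr0 ltNge dy1.
  have : 1 <= `|w%:~R : R|.
    by rewrite -intr_norm ler1z -gtz0_ge1 normr_gt0.
  have := ler_distD (d%:R * y) w%:~R 0.
  rewrite !subr0 distrC => h h1.
  have := le_lt_trans (le_trans h1 h) (ltr_leD dy dy2).
  by rewrite addrC subrK ltxx.
by rewrite big1// => i _; rewrite h.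
Qed.

End Rotation.

(** * Few words that reach most cells of the rotation *)

Section MeanCover.
Set Implicit Arguments. Unset Strict Implicit. Unset Printing Implicit Defensive.
Context {R : realType} (E : (nat -> R) -> R) (mE : mean E).

Definition visited (T Q : finType) (f : nat -> T) (q : nat -> Q)
    (K : nat -> bool) (Ms : {set T}) : {set Q} :=
  [set a : Q | `[< exists j, [/\ K j, f j \in Ms & q j = a] >] ]%SET.

(** [cover_mass] is applied to the good pairs seen during [K], with words drawn by the law of [f];
    the middle term pays for the times in bad pairs. *)
Lemma mass_visited (T Q : finType) (f : nat -> T) (q : nat -> Q)
    (K : nat -> bool) (Lam : R) (M : nat) : 0 < Lam -> (0 < M)%N ->
  exists Ms : {set T}, (#|Ms| <= M)%N /\
    E (fun j => (K j)%:R) <= \sum_(a in visited f q K Ms) law E q a +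
      E (fun j => (~~ good_pair E f q Lam (f j, q j))%:R) + Lam / M%:R.
Proof.
move=> L0 M0; pose fq j := (f j, q j); pose good := good_pair E f q Lam.
pose nu u := E (fun j => (K j && (fq j == u))%:R).
have nu0 u : 0 <= nu u by apply: mean_ge0 => //; exact: bounded_ind.
have nule u : nu u <= law E fq u.
  apply: mean_le => //; try exact: bounded_ind.
  by move=> j; rewrite ler_nat; case: (K j) => //; rewrite leq_b1.
(* Positive mass guarantees that the pair occurs at some time of [K], so that choosing [w] really
   makes [a] visited. *)
pose c w a := (0 < nu (w, a)) && good (w, a).
pose b a := \sum_(w | c w a) nu (w, a).
have b0 a : 0 <= b a by apply: sumr_ge0.
have [|Ms [cM hM]] := cover_mass (law_ge0 mE f) (law_sum1 mE f)
  (law_ge0 mE q) (law_sum1 mE q) b0 (ltW L0) M0 (c := c) _.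
  move=> a; rewrite mulr_sumr; apply: ler_sum => w /andP[_ gw].
  by apply: le_trans (nule _) _; rewrite -mulrA [X in _ * X]mulrC; exact: gw.
exists Ms; split => //.
have bq a : b a <= law E q a.
  rewrite -(law_marginal mE f q) /b big_mkcond; apply: ler_sum => w _.
  by case: ifP => _; rewrite ?law_ge0// nule.
have sb : \sum_a b a = E (fun j => \sum_u (good u)%:R * (K j && (fq j == u))%:R).
  rewrite mean_sum// => [|u]; last by apply: boundedZ; exact: bounded_ind.
  transitivity (\sum_u (good u)%:R * nu u); last first.
    by apply: eq_bigr => u _; rewrite (meanZ mE)//; exact: bounded_ind.
  transitivity (\sum_w \sum_a (good (w, a))%:R * nu (w, a)); last first.
    by rewrite (pair_bigA _ (fun w a => (good (w, a))%:R * nu (w, a)))/=;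
      apply: eq_bigr => -[].
  rewrite exchange_big/=; apply: eq_bigr => a _.
  rewrite /b big_mkcond; apply: eq_bigr => w _; rewrite /c.
  have := nu0 (w, a); rewrite le_eqVlt => /predU1P[<-|->].
    by rewrite ltxx mulr0.
  by case: (good _) => /=; rewrite ?mul1r ?mul0r.
apply: (@le_trans _ _ (\sum_a b a +
    E (fun j => (~~ good (fq j))%:R))); last first.
  rewrite [leRHS]addrAC lerD2r (bigID (fun a => [exists w in Ms, c w a]))/=.
  rewrite lerD//; apply: (@le_trans _ _ (\sum_(a | [exists w in Ms, c w a]) law E q a)).
    exact: ler_sum.
  rewrite big_mkcond [leRHS]big_mkcond; apply: ler_sum => a _.
  case: ifP => [/existsP[w /andP[wM /andP[nuw _]]]|_]; last first.
    by case: ifP => // _; exact: law_ge0.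
  case: ifPn => //; rewrite inE => /asboolP nex; exfalso.
  suff : nu (w, a) = 0 by move=> e; rewrite e ltxx in nuw.
  rewrite -[RHS](mean_cst mE 0); congr E; apply/funext => j.
  case: (boolP (K j && _)) => // /andP[Kj /eqP[fj qj]]; exfalso.
  by apply: nex; exists j; rewrite fj.
rewrite sb -(meanD mE); first last.
- exact: bounded_ind.
- by apply: bounded_sum => u; apply: boundedZ; exact: bounded_ind.
apply: mean_le => //; first exact: bounded_ind.
  apply: boundedD; last exact: bounded_ind.
  by apply: bounded_sum => u; apply: boundedZ; exact: bounded_ind.
move=> j; case: (K j) => /=; last first.
  by rewrite addr_ge0// sumr_ge0// => u _; rewrite mulr_ge0.
case: (boolP (good (fq j))) => gj /=; last first.
  by rewrite lerDr sumr_ge0// => u _; rewrite mulr_ge0.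
rewrite addr0 (bigD1 (fq j))//= gj eqxx mulr1 lerDl.
by rewrite sumr_ge0// => u _; rewrite mulr_ge0.
Qed.

Variables (alpha : R) (ir : irrational alpha).

Lemma card_visited (T : finType) (f : nat -> T) (K : nat -> bool) m (Ms : {set T}) :
  (1 < m)%N -> m%:R * \sum_(a in visited f (cell alpha m) K Ms) law E (cell alpha m) a
    <= #|visited f (cell alpha m) K Ms|%:R.
Proof.
move=> m1; rewrite mulr_sumr -sum1_card natr_sum; apply: ler_sum => a _.
exact: cell_law.
Qed.

(** Serves the small lengths, for which all words are kept. *)
Lemma visited_setT (T : finType) (f : nat -> T) (K : nat -> bool) m :
  (1 < m)%N -> m%:R * E (fun j => (K j)%:R)
    <= #|visited f (cell alpha m) K finset.setT|%:R.
Proof.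
move=> m1; apply: le_trans (card_visited f K _ m1); rewrite ler_wpM2l//.
set V := visited _ _ _ _.
have -> : \sum_(a in V) law E (cell alpha m) a = E (fun j => (cell alpha m j \in V)%:R).
  rewrite (mean_comp mE (cell alpha m) (fun a => (a \in V)%:R)) big_mkcond.
  by apply: eq_bigr => a _; case: ifP; rewrite ?mulr1 ?mulr0.
apply: (mean_le mE); try exact: bounded_ind.
move=> j; case: (boolP (K j)) => // Kj; rewrite ler_nat.
rewrite (_ : cell alpha m j \in V)// inE; apply/asboolP.
by exists j; rewrite finset.in_setT.
Qed.

Variables (k : nat) (l : nat -> 'I_k).

(** The last two hypotheses each pay one loss of [delta]: the mass of bad pairs, through mutual
    information at most [N * g + n1 * (h + g)], and the uncovered mass [Lam / M] with
    [Lam = expR (N%:R * th)]. *)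
Lemma words_visited (K : nat -> bool) (h g th delta : R) (n1 N M m : nat) :
  0 <= h -> 0 <= g -> 0 < th -> (0 < n1)%N -> (0 < N)%N -> (0 < M)%N -> (1 < m)%N ->
  (forall n, n%:R * h <= ent E (word l n)) ->
  ent E (word l n1) <= n1%:R * (h + g) ->
  N%:R * g + n1%:R * (h + g) + 1 <= delta * (N%:R * th) ->
  expR (N%:R * th) <= delta * M%:R ->
  exists Ms : {set {ffun 'I_N -> 'I_k}}, (#|Ms| <= M)%N /\
    m%:R * (E (fun j => (K j)%:R) - 2 * delta) <=
      #|visited (word l N) (cell alpha m) K Ms|%:R.
Proof.
move=> h0 g0 th0 n10 N0 M0 m1 hlb hub hN hM.
have [Ms [cM mass]] := mass_visited (word l N) (cell alpha m) K
  (expR_gt0 (N%:R * th)) M0.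
exists Ms; split => //; apply: le_trans (card_visited _ _ _ m1).
rewrite ler_wpM2l//.
have : expR (N%:R * th) / M%:R <= delta by rewrite ler_pdivrMr ?ltr0n.
suff : E (fun j => (~~ good_pair E (word l N) (cell alpha m)
  (expR (N%:R * th)) (word l N j, cell alpha m j))%:R) <= delta by lra.
have Nth : 0 < N%:R * th by rewrite mulr_gt0 ?ltr0n.
rewrite -(ler_pM2r Nth); apply: le_trans hN.
have := bad_mass mE (word l N) (cell alpha m) (expR_gt0 (N%:R * th)).
rewrite expRK => /le_trans; apply.
(* The cells are coded for every [m], so the bound is uniform in [m]. *)
have := cent_word_lb (q := cell alpha m) (M := m.+1) (n := N)
  mE hlb (cell_code alpha m N).
have := ent_word_ub mE N n10 (addr_ge0 h0 g0) hub.
rewrite natrD; lra.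
Qed.

End MeanCover.

(** * Lebesgue measure of a closure *)

Section ClosureMeasure.
Set Implicit Arguments. Unset Strict Implicit. Unset Printing Implicit Defensive.
Context {R : realType}.

Definition cell_itv_set (m : nat) (c : 'I_m.+1) : set R :=
  `[c%:R / m.+1%:R, c.+1%:R / m.+1%:R[%classic.

Lemma lebesgue_cells m (C : {set 'I_m.+1}) :
  (@lebesgue_measure R (\big[setU/set0]_(c in C) cell_itv_set c) =
   (#|C|%:R / m.+1%:R)%:E)%E.
Proof.
have m0 : 0 < m.+1%:R :> R by rewrite ltr0n.
rewrite measure_bigsetU_ord_cond//=; first last.
- move=> c c' _ _ [x []]; rewrite /cell_itv_set/= !in_itv/=.
  rewrite !ler_pdivrMr// !ltr_pdivlMr// => /andP[a1 a2] /andP[b1 b2].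
  have := le_lt_trans a1 b2; have := le_lt_trans b1 a2.
  rewrite !ltr_nat !ltnS => h1 h2.
  by apply: val_inj; apply/eqP; rewrite eqn_leq h1 h2.
- by move=> c _; exact: measurable_itv.
rewrite (eq_bigr (fun=> (m.+1%:R^-1)%:E)); last first.
  move=> c _; rewrite /cell_itv_set lebesgue_measure_itv/= lte_fin.
  rewrite ltr_pM2r ?invr_gt0// ltr_nat ltnSn -EFinD -mulrBl -natr1 addrAC subrr.
  by rewrite add0r mul1r.
by rewrite sumEFin sumr_const mulr_natl.
Qed.

(** The closure is the decreasing intersection of the neighbourhoods [V s], and [V s] contains every
    sufficiently fine cell that meets [D]; continuity from above concludes. *)
Lemma lebesgue_closure_ge (D : set R) (e : R) :
  D `<=` `[0, 1]%classic ->
  (forall m0 : nat, exists m : nat, (m0 <= m)%N /\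
     e * m.+1%:R <= #|[set c : 'I_m.+1 | `[< D `&` cell_itv_set c !=set0 >]]%SET|%:R) ->
  (e%:E <= @lebesgue_measure R (closure D))%E.
Proof.
move=> D01 hD.
pose V (s : nat) : set R := \bigcup_(y in D) ball y s.+1%:R^-1.
have oV s : open (V s) by apply: bigcup_open => y _; exact: ball_open.
have mV s : measurable (V s : set (measurableTypeR R)) by exact: open_measurable.
have clV : closure D = \bigcap_s V s.
  rewrite eqEsubset; split => x.
    move=> cx s _; have [|y [Dy]] := cx (ball x s.+1%:R^-1).
      exact: nbhsx_ballx.
    by move=> /ball_sym xy; exists y.
  move=> hx B /nbhs_ballP[r /= r0 rB].
  have [y Dy yx] := hx (Num.truncn r^-1) I; exists y; split => //.
  apply: rB; apply: ball_sym; apply: le_ball yx.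
  rewrite -[leRHS]invrK lef_pV2 ?posrE ?invr_gt0//.
  by apply: ltW; exact: truncnS_gt.
have V0 : (@lebesgue_measure R (V 0%N) < +oo)%E.
  apply: (@le_lt_trans _ _ (@lebesgue_measure R `[-1, 2]%classic)).
    apply: le_measure; rewrite ?inE//.
    move=> x [y /D01]; rewrite /= !in_itv/= invr1 /ball/= ltr_norml.
    by move=> /andP[y0 y1] /andP[x0 x1]; apply/andP; split; lra.
  by rewrite lebesgue_measure_itv/= lte_fin; case: ifP => _; rewrite ltry.
have niV : nonincreasing_seq V.
  move=> s t st; apply/subsetPset => x [y Dy yx]; exists y => //.
  by apply: le_ball yx; rewrite lef_pV2 ?posrE// ler_nat.
have := @nonincreasing_cvg_mu _ (measurableTypeR R) R (@lebesgue_measure R) V V0 mV _ niV.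
rewrite -clV => /(_ _) cvV; rewrite -(cvg_lim _ (cvV _))//; last first.
  by apply: closed_measurable; exact: closed_closure.
apply: lime_ge.
  by apply/cvg_ex; eexists; apply: cvV; apply: closed_measurable; exact: closed_closure.
apply: nearW => s /=; have [m [sm hm]] := hD s.+1.
set C := [set c | _]%SET in hm.
apply: (@le_trans _ _ (#|C|%:R / m.+1%:R)%:E).
  by rewrite lee_fin ler_pdivlMr.
rewrite -lebesgue_cells; apply: le_measure; rewrite ?inE//.
  by apply: bigsetU_measurable => c _; exact: measurable_itv.
apply: (big_ind (fun A => A `<=` V s)) => [x []|A B AV BV x [/AV|/BV]//|c].
rewrite inE => /asboolP[y [Dy cy]] x cx; exists y => //.
have m0 : 0 < m.+1%:R :> R by rewrite ltr0n.
apply: (@le_ball _ _ _ m.+1%:R^-1).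
  by rewrite lef_pV2 ?posrE// ler_nat ltnS (leq_trans (leqnSn s)).
move: cy cx; rewrite /cell_itv_set/= !in_itv/= /ball/=.
rewrite -[c.+1%:R]natr1 mulrDl mul1r ltr_norml.
by move: (_^-1) => v /andP[y1 y2] /andP[x1 x2]; apply/andP; split; lra.
Qed.

End ClosureMeasure.

(** * Frequencies of visits *)

Section Visits.
Set Implicit Arguments. Unset Strict Implicit. Unset Printing Implicit Defensive.
Context {R : realType} {T : Type} (S : T -> T).

Definition visits (B : set T) n (x : T) : R := \sum_(i < n) \1_B (iter i S x).

(** Asking for unbounded excess makes this set exactly invariant, so that ergodicity applies to it
    directly. *)
Definition excess (B : set T) (a : R) : set T :=
  [set x | forall C : nat, exists n : nat, C%:R <= visits B n x - n%:R * a].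

Lemma visitsD B m n x : visits B (m + n) x = visits B m x + visits B n (iter m S x).
Proof.
rewrite /visits big_split_ord/=; congr (_ + _); apply: eq_bigr => i _.
by rewrite addnC iterD.
Qed.

Lemma visits1 B x : visits B 1 x = \1_B x.
Proof. by rewrite /visits big_ord1. Qed.

(** One step of the orbit changes the excess by at most [1 + |a|]. *)
Lemma excess_invariant B a : S @^-1` excess B a = excess B a.
Proof.
have ind01 x : 0 <= (\1_B x : R) <= 1.
  by rewrite indicE; case: (_ \in _); rewrite ?lexx ?ler01.
have [K hK] : exists K : nat, `|a| <= K%:R.
  by exists (Num.truncn `|a|).+1; rewrite ltW// truncnS_gt.
apply/seteqP; split => x h C.
  have [n hn] := h (C + K)%N; exists n.+1.
  rewrite -add1n visitsD visits1 natrD mulrDl mul1r.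
  have /andP[i0 i1] := ind01 x.
  move: hn hK; rewrite natrD ler_norml => hn /andP[a0 a1]; rewrite /=; lra.
(* The extra 1 rules out [n = 0]. *)
have [n] := h (C + K + 1)%N; case: n => [|n].
  rewrite /visits big_ord0 mul0r subrr -[0]/(0%:R) ler_nat addn1.
  by rewrite ltn0.
rewrite -[n.+1]add1n visitsD visits1 [(1 + n)%:R]natrD mulrDl mul1r => hn.
exists n; have /andP[i0 i1] := ind01 x.
move: hn hK; rewrite !natrD ler_norml => hn /andP[a0 a1]; rewrite /= in hn *; lra.
Qed.

(* The orbit is cut greedily into blocks of length at most [M] on which the mean
   number of visits is at least [a], and single times spent in [N]. *)
Lemma visits_blocks (B N : set T) (a : R) (M : nat) : 0 <= a ->
  (forall x, ~ N x -> exists n, [/\ (0 < n)%N, (n <= M)%N & n%:R * a <= visits B n x]) ->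
  forall L x, (L%:R - M%:R) * a <= visits B L x + a * visits N L x.
Proof.
move=> a0 hN L; have [n] := ubnP L; elim: n L => // n IH L; rewrite ltnS => Ln x.
have v0 A m y : 0 <= visits A m y :> R by apply: sumr_ge0.
(* A remainder no longer than [M] is given up: the left-hand side is then nonpositive. *)
have [LM|ML] := leqP L M.
  apply: (@le_trans _ _ 0).
    by rewrite mulr_le0_ge0// subr_le0 ler_nat.
  by rewrite addr_ge0// mulr_ge0.
have [Nx|/hN[m [m0 mM hm]]] := pselect (N x).
  case: L Ln ML => // L Ln ML.
  have := IH L Ln (S x); rewrite -[L.+1]add1n !visitsD !visits1 natrD.
  have -> : (\1_N x : R) = 1 by rewrite indicE mem_set.
  have : 0 <= (\1_B x : R) by [].
  move: (v0 B L (S x)) (v0 N L (S x)); rewrite /=; nra.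
have mL : (m <= L)%N by apply: leq_trans mM (ltnW ML).
have := IH (L - m)%N _ (iter m S x).
have vD A : visits A L x = visits A m x + visits A (L - m) (iter m S x).
  by rewrite -visitsD subnKC.
rewrite !vD natrB//.
have : (L - m < n)%N by rewrite (leq_trans _ Ln)// ltn_subrL m0 (leq_ltn_trans _ ML).
move=> -> /(_ isT); have := mulr_ge0 a0 (v0 N m x).
by rewrite mulrDr; lra.
Qed.

End Visits.

(** * Upper bound for visit frequencies in an ergodic system *)

Section ErgodicUpperBound.
Set Implicit Arguments. Unset Strict Implicit. Unset Printing Implicit Defensive.
Context {R : realType} d (T : measurableType d) (mu : probability T R) (S : T -> T).
Hypothesis mS : measurable_fun setT S.
Hypothesis preS : forall B, measurable B -> mu (S @^-1` B) = mu B.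
Hypothesis ergS : forall B, measurable B -> S @^-1` B = B -> mu B = 0%E \/ mu B = 1%E.

Lemma measurable_iter n : measurable_fun setT (iter n S).
Proof.
elim: n => [|n IH]; first exact: measurable_id.
exact: measurableT_comp mS IH.
Qed.

Lemma measurable_iter_preimage n B : measurable B -> measurable (iter n S @^-1` B).
Proof. by move=> mB; rewrite -[X in measurable X]setTI; exact: measurable_iter. Qed.

Lemma preserving_iter n B : measurable B -> mu (iter n S @^-1` B) = mu B.
Proof.
move=> mB; elim: n => [//|n IH]; rewrite -IH -(preS (measurable_iter_preimage n mB)).
by congr (mu _); apply/seteqP; split => x; rewrite /preimage/= -iterSr.
Qed.

Lemma measurable_visits B n : measurable B -> measurable_fun setT (visits S B n : T -> R).
Proof.
move=> mB; apply: measurable_sum => i.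
apply: measurableT_comp; last exact: measurable_iter.
exact: measurable_indic.
Qed.

Lemma measurable_excess B (a : R) : measurable B -> measurable (excess S B a).
Proof.
move=> mB.
have -> : excess S B a = \bigcap_C \bigcup_n
    ((fun x => visits S B n x - n%:R * a) @^-1` `[(C : nat)%:R, +oo[%classic).
  apply/seteqP; split => x.
    by move=> h C _; have [n hn] := h C; exists n => //=; rewrite in_itv/= hn.
  by move=> h C; have [n _ /=] := h C I; rewrite in_itv/= andbT => hn; exists n.
apply: bigcap_measurable => // C _; apply: bigcup_measurable => n _.
rewrite -[X in measurable X]setTI.
have mf : measurable_fun setT (fun x => visits S B n x - n%:R * a).
  by apply: measurable_funB => //; exact: measurable_visits.
by apply: mf => //; exact: measurable_itv.
Qed.

Lemma visits_integral B n : measurable B ->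
  (\int[mu]_x (visits S B n x)%:E = (n%:R * fine (mu B))%:E)%E.
Proof.
move=> mB.
under eq_integral do rewrite -sumEFin.
rewrite (@ge0_integral_sum _ _ _ mu setT measurableT 'I_n
  (fun i x => (\1_B (iter i S x))%:E)).
- rewrite (eq_bigr (fun=> (fine (mu B))%:E)).
    by rewrite sumEFin sumr_const card_ord mulr_natl.
  move=> i _; rewrite fineK ?fin_num_measure//.
  rewrite -(preserving_iter i mB) -[in RHS](setIT (iter i S @^-1` B)).
  by rewrite -integral_indic//; exact: measurable_iter_preimage.
- move=> i; apply/measurable_EFinP; apply: measurableT_comp => //.
  exact: measurable_iter.
- by move=> i x _; rewrite lee_fin.
Qed.

(** Otherwise the excess set has mass 1, so almost every point starts a block of visit frequency at
    least [a], of length at most [M] outside a set of small mass [e]. Integrating [visits_blocks]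
    then gives [(L - M) * a <= L * (b + a * e)], false for large [L]. *)
Lemma excess_null B (a : R) : measurable B -> (mu B < a%:E)%E ->
  mu (excess S B a) = 0%E.
Proof.
move=> mB Ba.
have a0 : 0 < a by rewrite -lte_fin; apply: le_lt_trans Ba; exact: measure_ge0.
have [//|G1] := ergS (measurable_excess a mB) (excess_invariant S B a).
pose Bad M := \bigcap_(n in [set n : nat | (0 < n)%N /\ (n <= M)%N])
  ((fun x => visits S B n x) @^-1` `]-oo, (n%:R * a)[%classic).
have mBad M : measurable (Bad M).
  apply: bigcap_measurableType => n _.
  rewrite -[X in measurable X]setTI; apply: measurable_visits => //.
have niBad : nonincreasing_seq Bad.
  move=> M M' MM; apply/subsetPset => x h n [n0 nM]; apply: h; split => //.
  exact: leq_trans nM MM.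
have capBad : mu (\bigcap_M Bad M) = 0%E.
  apply/eqP; rewrite eq_le measure_ge0 andbT.
  apply: (@le_trans _ _ (mu (~` excess S B a))).
    apply: le_measure; rewrite ?inE.
    - by apply: bigcap_measurable.
    - by apply: measurableC; exact: measurable_excess.
    move=> x h /(_ 1%N)[n]; case: n => [|n].
      by rewrite /visits big_ord0 mul0r subrr ler10.
    have /= := h n.+1 I n.+1 (conj isT (leqnn _)); rewrite in_itv/= => hlt.
    by rewrite lerBrDr leNgt => /negP; apply; rewrite (lt_le_trans hlt)// lerDr.
  by rewrite probability_setC; [rewrite G1 subee|exact: measurable_excess].
have cBad : (fun M => fine (mu (Bad M))) @ \oo --> 0.
  apply: fine_cvg; rewrite (_ : 0%:E = mu (\bigcap_M Bad M)); last by rewrite capBad.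
  apply: nonincreasing_cvg_mu => //.
    by rewrite (le_lt_trans (probability_le1 _ _))// ltry.
  exact: bigcap_measurable.
set b := fine (mu B).
have ba : b < a by rewrite -lte_fin fineK// fin_num_measure.
have b0 : 0 <= b by apply: fine_ge0.
(* This threshold gives [e * (a + 1) < a - b], hence [b + a * e < a]. *)
have eta0 : 0 < (a - b) / (a + 1) by rewrite divr_gt0 ?subr_gt0// addr_gt0.
have [M _ /(_ M (leqnn _)) /= hM] := cvgr_lt _ cBad _ eta0.
set e := fine _ in hM.
have d0 : 0 < a - b - a * e.
  rewrite ltr_pdivlMr ?addr_gt0// in hM.
  have : 0 <= e by apply: fine_ge0.
  nra.
have key L : (M <= L)%N -> (L%:R - M%:R) * a <= L%:R * b + a * (L%:R * e).
  move=> ML.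
  have blk := @visits_blocks R T S B (Bad M) a M (ltW a0) _ L.
  have {blk}blk x : (L%:R - M%:R) * a <= visits S B L x + a * visits S (Bad M) L x.
    apply: blk => y nB; apply: contrapT => h; apply: nB => n [n0 nM] /=.
    rewrite in_itv/= ltNge; apply/negP => hn; apply: h; exists n; split => //.
  have mv A : measurable A -> measurable_fun setT (fun x => (visits S A L x : R)%:E).
    by move=> mA; apply/measurable_EFinP; exact: measurable_visits.
  have v0 A x : 0 <= visits S A L x :> R by apply: sumr_ge0.
  rewrite -lee_fin [leRHS]EFinD [X in (_ + X)%E]EFinM -!visits_integral//.
  rewrite -ge0_integralZl_EFin//; [|by move=> x _; rewrite lee_fin|exact: mv|exact: ltW].
  rewrite -ge0_integralD//; first last.
  - by apply: measurable_funeM; exact: mv.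
  - by move=> x _; rewrite -EFinM lee_fin mulr_ge0// ltW.
  - exact: mv.
  - by move=> x _; rewrite lee_fin.
  apply: (@le_trans _ _ (\int[mu]_x (cst ((L%:R - M%:R) * a)%:E x))%E).
    rewrite (integral_cst mu measurableT) [X in (_ * X)%E](_ : _ = 1%E) ?mule1//.
    exact: probability_setT.
  apply: ge0_le_integral => //.
  - by move=> x _; rewrite lee_fin mulr_ge0 ?subr_ge0 ?ler_nat// ltW.
  - by apply: emeasurable_funD; [exact: mv|apply: measurable_funeM; exact: mv].
  - by move=> x _; rewrite /cst -EFinM -EFinD lee_fin.
exfalso; pose r := (Num.truncn (M%:R * a / (a - b - a * e))).+1.
have hr : M%:R * a < r%:R * (a - b - a * e).
  by rewrite -ltr_pdivrMr// truncnS_gt.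
have := key (M + r)%N (leq_addr _ _); rewrite natrD.
have : 0 <= M%:R * (a - b - a * e) by rewrite mulr_ge0// ltW.
by move: hr; lra.
Qed.

End ErgodicUpperBound.

(** * Word statistics along the orbits of typical points *)

Section Assembly.
Set Implicit Arguments. Unset Strict Implicit. Unset Printing Implicit Defensive.
Context {R : realType}.

(** The infimum of [H n / n] over positive [n] bounds every ratio and is nearly attained. *)
Lemma growth_rate (H : nat -> R) : (forall n, 0 <= H n) ->
  exists h, [/\ 0 <= h, (forall n, n%:R * h <= H n) &
    forall g, 0 < g -> exists2 n, (0 < n)%N & H n <= n%:R * (h + g)].
Proof.
move=> H0; pose B := range (fun n => H n.+1 / n.+1%:R).
have lB : lbound B 0 by move=> _ [n _ <-]; rewrite divr_ge0.
have B0 : B !=set0 by exists (H 1%N / 1%:R); exists 0%N.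
have hB : has_inf B by split => //; exists 0.
exists (inf B); split; first exact: lb_le_inf.
  case=> [|n]; first by rewrite mul0r.
  rewrite mulrC -ler_pdivlMr ?ltr0n//; apply: ge_inf; first by exists 0.
  by exists n.
move=> g g0; have [_ [n _ <-] /ltW] := inf_adherent g0 hB.
by rewrite ler_pdivrMr ?ltr0n// mulrC => h; exists n.+1.
Qed.

(** Otherwise each [t] fails from some [b t] on, and all fail at once beyond the sum of the
    [b t]. *)
Lemma pigeonhole_frequently (T : finType) (P : nat -> T -> Prop) :
  (forall m, (1 < m)%N -> exists t, P m t) ->
  exists t, forall m0, exists m, (m0 <= m)%N /\ P m t.
Proof.
move=> hP; apply/not_existsP => h.
have /choice[b hb] : forall t, exists m0, forall m, (m0 <= m)%N -> ~ P m t.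
  move=> t; apply/not_existsP => ht; apply: (h t) => m0.
  apply: contrapT => nm; apply: (ht m0) => m mm Pm; apply: nm.
  by exists m.
have [|t] := hP (\sum_t b t + 2)%N; first by rewrite addn2.
by apply: hb; rewrite (bigD1 t)//= -addnA leq_addr.
Qed.

(** The lower limit is the supremum of the infima of tails, and each such infimum eventually bounds
    the averages from below. *)
Lemma lower_density_le_mean (E : (nat -> R) -> R) (mE : mean E) (K : set nat) :
  lower_density R K <= E (fun j => (j \in K)%:R).
Proof.
pose f j : R := (j \in K)%:R.
have bf : bounded_seq f by exact: (bounded_ind (fun j => j \in K)).
have -> : lower_density R K = limn_inf (avg f).
  by congr limn_inf; apply/funext => n; rewrite /avg natr_sum.
have fle j : `|f j| <= 1 by rewrite /f; case: (j \in K); rewrite ?normr1 ?normr0.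
have bavg : bounded_fun (avg f : nat -> R^o).
  exists 1; split => // r r1 n _ /=.
  by apply: le_trans (ltW r1); exact: avg_bound.
rewrite limn_infE//; apply: ge_sup; first by exists (infs (avg f) 0%N); exists 0%N.
move=> _ [n _ <-]; apply: (mean_ge mE bf); exists n => // N /= nN.
rewrite /infs/=; apply: ge_inf; last by exists N.
by exists (-1) => _ [k _ <-]; have := avg_bound fle k; rewrite ler_norml => /andP[].
Qed.

Context (X : pseudoPMetricType R) (mu : probability (borelType X) R) (S : X -> X).
Context (k : nat) (A : 'I_k -> set X).
Hypotheses (mpS : measure_preserving mu S) (ergS : ergodic mu S).
Hypothesis pA : is_fin_partition A.

Lemma measurable_cylinder n (w : {ffun 'I_n -> 'I_k}) :
  measurable (cylinder A S w : set (borelType X)).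
Proof.
have -> : cylinder A S w = \bigcap_(i : 'I_n) (iter i S @^-1` (A (w i))).
  by apply/seteqP; split => x h; [move=> i _; exact: h|move=> i; exact: (h i I)].
apply: fin_bigcap_measurable; first exact: finite_finset.
move=> i _; apply: (@measurable_iter_preimage _ (borelType X) S mpS.1).
exact: pA.1.
Qed.

Lemma cylinder_disjoint n (w w' : {ffun 'I_n -> 'I_k}) x :
  cylinder A S w x -> cylinder A S w' x -> w = w'.
Proof.
move=> h h'; apply/ffunP => i; apply/eqP; apply: contraT => ne.
have := pA.2.1 _ _ ne; rewrite -subset0 => /(_ (iter i S x)).
by case; split; [exact: h|exact: h'].
Qed.

Lemma sum_cylinder_le1 n :
  \sum_(w : {ffun 'I_n -> 'I_k}) fine (mu (cylinder A S w)) <= 1.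
Proof.
rewrite -lee_fin -sumEFin.
rewrite (eq_bigr (fun w : {ffun 'I_n -> 'I_k} => mu (cylinder A S w))); last first.
  by move=> w _; rewrite fineK//; apply: fin_num_measure; exact: measurable_cylinder.
rewrite (big_enum_val (A := {ffun 'I_n -> 'I_k}))/=.
rewrite -(@measure_bigsetU_ord_cond _ _ _ mu _ xpredT
  (fun i => cylinder A S (enum_val i : {ffun 'I_n -> 'I_k}))).
- apply: probability_le1; apply: bigsetU_measurable => i _.
  exact: measurable_cylinder.
- by move=> i _; exact: measurable_cylinder.
- move=> i j _ _ [x [xi xj]]; apply: enum_val_inj.
  exact: cylinder_disjoint xi xj.
Qed.

(* One-sided bounds suffice: the upper bounds for the frequencies of all words
   of length [n] sum to 1. *)
Definition generic (x : X) := forall n (w : {ffun 'I_n -> 'I_k}) (s : nat),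
  ~ excess S (cylinder A S w) (fine (mu (cylinder A S w)) + s.+1%:R^-1) x.

Lemma generic_full : exists X' : set (borelType X),
  [/\ measurable X', mu X' = 1%E & forall x, X' x -> generic x].
Proof.
(* A countable type, so the exceptional null sets can be indexed by the naturals. *)
pose code := ({n : nat & {ffun 'I_n -> 'I_k}} * nat)%type.
pose Bad (i : nat) : set (borelType X) :=
  if (unpickle i : option code) is Some (existT n w, s) then
    excess S (cylinder A S w) (fine (mu (cylinder A S w)) + s.+1%:R^-1)
  else set0.
have mBad i : measurable (Bad i) /\ mu (Bad i) = 0%E.
  rewrite /Bad; case: unpickle => [[[n w] s]|]; last by rewrite measure0.
  split.
    apply: (@measurable_excess R _ (borelType X) S mpS.1).
    exact: measurable_cylinder.
  apply: (excess_null mpS.1 mpS.2 ergS); first exact: measurable_cylinder.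
  rewrite -[ltLHS]fineK; last by apply: fin_num_measure; exact: measurable_cylinder.
  by rewrite lte_fin ltrDl.
have mU : measurable (\bigcup_i Bad i).
  by apply: bigcupT_measurable => i; have [] := mBad i.
exists (~` \bigcup_i Bad i); split; first exact: measurableC.
  rewrite probability_setC// (_ : mu (\bigcup_i Bad i) = 0%E) ?sube0//.
  apply/negligibleP => //; apply: negligible_bigcup => i.
  by have [? ?] := mBad i; exact/negligibleP.
move=> x h n w s ex; apply: h; exists (pickle ((existT _ n w, s) : code)) => //.
by rewrite /Bad pickleK.
Qed.

Section GenericPoint.
Variables (x : X) (gx : generic x) (l : nat -> 'I_k).
Hypothesis lP : forall j, A (l j) (iter j S x).
Variables (E : (nat -> R) -> R) (mE : mean E).

Lemma cylinder_word n (w : {ffun 'I_n -> 'I_k}) j :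
  cylinder A S w (iter j S x) <-> word l n j = w.
Proof.
have h : cylinder A S (word l n j) (iter j S x).
  by move=> i; rewrite ffunE -iterD addnC.
by split => [hw|<-//]; exact: cylinder_disjoint h hw.
Qed.

(** Off the excess set, visits beyond the frequency [a + s.+1%:R^-1] stay bounded, so the averages
    are eventually at most [a + e]. *)
Lemma law_word_le n w : law E (word l n) w <= fine (mu (cylinder A S w)).
Proof.
set a := fine _; apply/ler_addgt0Pr => e e0.
have a0 : 0 <= a by apply: fine_ge0.
pose s := Num.truncn (2 / e).
have se : s.+1%:R^-1 <= e / 2.
  rewrite -[leRHS]invrK lef_pV2 ?posrE ?invr_gt0 ?divr_gt0// invf_div.
  by apply: ltW; exact: truncnS_gt.
have /existsNP[C /forallNP hC] := @gx n w s.
apply: mean_le_cst => //; first exact: bounded_ind.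
pose c : R := C%:R + (a + s.+1%:R^-1).
exists (Num.truncn (2 * c / e)).+1 => // N /= hN.
rewrite /avg ler_pdivrMr ?ltr0n//.
(* [visits] starts at time 0 and [avg] at time 1, hence [N.+2]; the constant [c] absorbs the extra
   time. *)
have := hC N.+2; rewrite -/a => /negP; rewrite -ltNge ltrBlDr => hv.
apply: le_trans (_ : visits S (cylinder A S w) N.+2 x <= _).
  rewrite /visits -(big_mkord xpredT (fun i => \1_(cylinder A S w) (iter i S x))).
  rewrite [leRHS]big_nat_recl//= [leLHS]big_add1/=.
  rewrite -[leLHS]add0r lerD//; apply: ler_sum => i _.
  rewrite indicE ler_nat; case: eqP => // /(cylinder_word w i.+1).2 h.
  by rewrite mem_set.
apply: le_trans (ltW hv) _; rewrite -[N.+2%:R]natr1.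
have : c * 2 <= e * N.+1%:R.
  rewrite -ler_pdivrMl// mulrC [c * 2]mulrC; apply: ltW.
  apply: lt_le_trans (truncnS_gt _) _.
  by rewrite ler_nat (leq_trans hN).
have : 0 < N.+1%:R :> R by [].
rewrite /c; move: (s.+1%:R^-1) se (N.+1%:R) => v ve y; nra.
Qed.

(** The gaps in [law_word_le] are nonnegative and their sum is at most [1 - 1], so all vanish. *)
Lemma law_word n w : law E (word l n) w = fine (mu (cylinder A S w)).
Proof.
pose F w := fine (mu (cylinder A S (w : {ffun 'I_n -> 'I_k}))) - law E (word l n) w.
have F0 v : 0 <= F v by rewrite subr_ge0 law_word_le.
apply/esym/eqP; rewrite -subr_eq0; apply/eqP.
apply: (psumr_eq0P (P := xpredT) (fun v _ => F0 v)) => //.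
apply/eqP; rewrite eq_le sumr_ge0// andbT sumrB law_sum1//.
by rewrite subr_le0 sum_cylinder_le1.
Qed.

(** The entropy is thus the same along every generic orbit, so the constants can be fixed before [x]
    and [K]. *)
Lemma ent_word n : ent E (word l n) = join_entropy mu S A n.
Proof.
rewrite /ent /join_entropy /part_entropy; congr (- _).
by apply: eq_bigr => w _; rewrite law_word.
Qed.

End GenericPoint.

Lemma itinerary x : exists l : nat -> 'I_k, forall j, A (l j) (iter j S x).
Proof.
have /choice[l lP] : forall j, exists i, A i (iter j S x).
  by move=> j; exact: pA.2.2.
by exists l.
Qed.

End Assembly.

(** * From visited cells to the measure of the closure *)

Section FinalStep.
Set Implicit Arguments. Unset Strict Implicit. Unset Printing Implicit Defensive.
Context {R : realType}.

Lemma closure_visited_ge (alpha eps rho : R) (T : finType) (f : nat -> T)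
    (K : nat -> bool) (Ms : {set T}) (D : set R) : 0 < eps < rho ->
  (forall j, K j -> f j \in Ms -> D (fracpart (j%:R * alpha))) ->
  D `<=` `[0, 1]%classic ->
  (forall m0, exists m, (m0 <= m)%N /\
    m%:R * rho <= #|visited f (cell alpha m) K Ms|%:R) ->
  (eps%:E <= @lebesgue_measure R (closure D))%E.
Proof.
move=> /andP[e0 er] KD D01 h; apply: lebesgue_closure_ge => // m0.
have r0 : 0 < rho - eps by rewrite subr_gt0.
(* From [eps / (rho - eps)] on, [m * rho] is at least [eps * (m + 1)], which makes up for the [m.+1]
   cells. *)
have [m [mm hm]] := h (m0 + (Num.truncn (eps / (rho - eps))).+1)%N.
exists m; split; first by apply: leq_trans mm; exact: leq_addr.
apply: (@le_trans _ _ (m%:R * rho)).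
  have : eps / (rho - eps) <= m%:R.
    apply: ltW; apply: lt_le_trans (truncnS_gt _) _.
    by rewrite ler_nat (leq_trans _ mm)// leq_addl.
  rewrite ler_pdivrMr// -natr1; move: (m%:R : R) => y; lra.
apply: le_trans hm _; rewrite ler_nat; apply: subset_leq_card.
apply/fintype.subsetP => c; rewrite !finset.in_set => /asboolP[j [Kj fj <-]].
apply/asboolP; apply: (ex_intro _ (fracpart (j%:R * alpha))).
split; first exact: KD.
by rewrite /cell_itv_set/= in_itv/=; exact: cell_fracpart.
Qed.

Lemma fracpart_itv (x : R) : fracpart x \in `[0, 1].
Proof.
have := floor_itv x; rewrite intrD mulr1z in_itv/= /fracpart.
by move=> /andP[? ?]; apply/andP; split; lra.
Qed.

End FinalStep.

Theorem theorem9p9 (R : realType) (X : pseudoPMetricType R)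
  (mu : probability (borelType X) R) (S : X -> X)
  (k : nat) (A : 'I_k -> set X) (eps alpha : R) :
  hausdorff_space X -> compact [set: X] ->
  measure_preserving mu S -> ergodic mu S -> (0 < ks_entropy mu S)%E ->
  is_fin_partition A -> generating S A ->
  (forall (i : nat) (j : 'I_k),
      mu (boundary ((iter i S) @^-1` (A j)) : set (borelType X)) = 0%E) ->
  0 < eps < 1 -> irrational alpha ->
  forall delta : R, 0 < delta < 1 ->
  exists c : R, 0 < c /\
  exists X' : set (borelType X), measurable X' /\ mu X' = 1%E /\
  forall n : nat, (1 <= n)%N ->
  forall x : X, X' x ->
  forall K : set nat, 2 * delta + eps < lower_density R K ->
  exists Mn : {set {ffun 'I_n.+1 -> 'I_k}},
    (#|Mn|%:R <= c * 2 `^ (n%:R * delta)) /\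
    (eps%:E <= (@lebesgue_measure R)
       (closure [set fracpart (j%:R * alpha)%R | j in
          K `&` [set j | (\bigcup_(w in [set w | w \in Mn]) cylinder A S w)
                           (iter j S x)]]))%E.
Proof.
move=> _ _ mpS ergS _ pA _ _ /andP[eps0 _] ir delta /andP[de0 de1].
have [E mE] := @mean_exists R.
have [X' [mX' X'1 X'g]] := generic_full mpS ergS pA.
have H0 n : 0 <= join_entropy mu S A n.
  have [x X'x] : X' !=set0.
    by apply/set0P/eqP => X'0; move: X'1; rewrite X'0 measure0 => /eqP;
      rewrite eqe eq_sym oner_eq0.
  have [l lP] := itinerary S pA x.
  by rewrite -(ent_word mpS pA (X'g x X'x) lP mE) ent_ge0.
have [h [h0 hlb hub]] := growth_rate H0.
have ln20 : 0 < ln 2 :> R by rewrite ln_gt0// ltr1n.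
(* With [th], [expR (n%:R * th)] is [2^(n delta)]. With [g], the term [N * g] uses half of the
   budget [delta * N * th], and from [n0] on the constant terms fit in the other half. *)
pose th := delta * ln 2; pose g := th * delta / 2.
have th0 : 0 < th by rewrite mulr_gt0.
have g0 : 0 < g by rewrite divr_gt0// mulr_gt0.
have [n1 n10 hn1] := hub g g0.
pose n0 := (Num.truncn ((n1%:R * (h + g) + 1) / g)).+1.
(* The first two terms serve the lengths from [n0] on; the last bounds the number of all words below
   [n0]. *)
pose c : R := 2 / delta + 1 + (k ^ n0.+1)%:R.
have c0 : 0 < 2 / delta :> R by rewrite divr_gt0.
exists c; split; first by rewrite ltr_wpDr// addr_gt0.
exists X'; split => //; split => // n n_gt0 x X'x K hK.
have [l lP] := itinerary S pA x.
have entE m : ent E (word l m) = join_entropy mu S A m.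
  exact (ent_word mpS pA (X'g x X'x) lP mE m).
have EK : 2 * delta + eps < E (fun j => (j \in K)%:R).
  exact: lt_le_trans hK (lower_density_le_mean mE K).
have pow2E y : 2 `^ y = expR (y * ln 2) :> R by rewrite /powR pnatr_eq0.
have pow1 : 1 <= 2 `^ (n%:R * delta) :> R.
  rewrite pow2E -[leLHS]expR0 ler_expR; apply: mulr_ge0; last exact: ltW.
  by apply: mulr_ge0 => //; exact: ltW.
have [Mn [cMn hMn]] : exists Mn : {set {ffun 'I_n.+1 -> 'I_k}},
    (#|Mn|%:R <= c * 2 `^ (n%:R * delta)) /\
    forall m0, exists m, (m0 <= m)%N /\ m%:R * (E (fun j => (j \in K)%:R) - 2 * delta) <=
      #|visited (word l n.+1) (cell alpha m) (fun j => j \in K) Mn|%:R.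
  (* The sets of words form a finite type that does not depend on [m], so one of them serves
     arbitrarily large [m]. *)
  suff /pigeonhole_frequently[Mn hMn] : forall m, (1 < m)%N ->
      exists Mn : {set {ffun 'I_n.+1 -> 'I_k}},
      (#|Mn|%:R <= c * 2 `^ (n%:R * delta)) /\
      m%:R * (E (fun j => (j \in K)%:R) - 2 * delta) <=
      #|visited (word l n.+1) (cell alpha m) (fun j => j \in K) Mn|%:R.
    exists Mn; split => [|m0]; first by have [m [_ []]] := hMn 0%N.
    by have [m [mm [_ hm]]] := hMn m0; exists m.
  move=> m m1; have [nn0|n0n] := ltnP n n0.
    exists finset.setT; split.
      rewrite cardsT card_ffun !card_ord; apply: (@le_trans _ _ (k ^ n0.+1)%:R).
        have k0 : (0 < k)%N by apply: leq_ltn_trans (ltn_ord (l 0%N)).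
        by rewrite ler_nat leq_pexp2l// leqW.
      rewrite -[leLHS]mulr1; apply: ler_pM => //.
      by rewrite /c lerDr addr_ge0// ltW.
    apply: le_trans (visited_setT mE ir (word l n.+1) (fun j => j \in K) m1).
    by rewrite ler_wpM2l// lerBlDr lerDl mulr_ge0// ltW.
  (* Large enough for [expR (n.+1%:R * th) <= delta * M%:R]. *)
  pose M := (Num.truncn (expR (n.+1%:R * th) / delta)).+1.
  have [||||Mn [cM hM]] := @words_visited R E mE alpha ir k l
    (fun j => j \in K) h g th delta n1 n.+1 M m h0 (ltW g0) th0 n10 isT isT m1.
  - by move=> N; rewrite entE.
  - by rewrite entE.
  - have : (n1%:R * (h + g) + 1) / g <= n.+1%:R.
      apply: ltW; apply: lt_le_trans (truncnS_gt _) _.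
      by rewrite ler_nat leqW.
    rewrite ler_pdivrMr// /g; move: (n.+1%:R : R) => y; lra.
  - rewrite [leRHS]mulrC -ler_pdivrMr//; apply: ltW; exact: truncnS_gt.
  exists Mn; split => //; apply: (@le_trans _ _ M%:R); first by rewrite ler_nat.
  apply: (@le_trans _ _ (expR (n.+1%:R * th) / delta + 1)).
    by rewrite /M -natr1 lerD2r truncn_le divr_ge0 ?expR_ge0// ltW.
  (* The words have length [n.+1]; the extra letter costs a factor [expR th], at most 2. *)
  have -> : expR (n.+1%:R * th) = expR (delta * ln 2) * 2 `^ (n%:R * delta).
    by rewrite pow2E -expRD /th -natr1; congr expR; ring.
  have : expR (delta * ln 2) <= 2 :> R.
    rewrite -[leRHS](@lnK R) ?posrE// ler_expR ger_pMl//; exact: ltW.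
  rewrite mulrAC /c; move: (expR _) => z z2.
  have kn0 : 0 <= (k ^ n0.+1)%:R :> R by [].
  have : z / delta <= 2 / delta by rewrite ler_wpM2r// invr_ge0 ltW.
  move: (z / delta) (2 / delta) (_ `^ _) ((k ^ n0.+1)%:R : R) kn0 pow1.
  move=> u v p q; nra.
have r0 : 0 < eps < E (fun j => (j \in K)%:R) - 2 * delta.
  by rewrite eps0 ltrBrDl.
exists Mn; split => //; apply: (closure_visited_ge r0 _ _ hMn).
  move=> j jK jM; exists j => //; split; first by rewrite inE in jK.
  exists (word l n.+1 j) => //.
  exact/(cylinder_word pA lP).
by move=> _ [j _ <-]; exact: fracpart_itv.
Qed.
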